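(* Let $G$ be a countable discrete group that contains no non-trivial finite subgroups, and let $\omega\in\beta G$. Then the following are equivalent: (i) $\omega$ is non-recurrent; (ii) $\mathcal{K}\cap\mathcal{A}_\omega\neq(0)$; (iii) $\mathcal{K}\subseteq\mathcal{A}_\omega$; (iv) $\pi_\omega:\mathcal{D}\to\mathcal{D}$ is onto; (v) $\mathcal{A}_\omega=\mathcal{D}\times_r G$; (vi) $\rho_\omega$ is one-to-one; (vii) $\omega$ is right cancellative.
   Context: $G$ is a countable discrete group with identity $1$, $\{e_g\}_{g\in G}$ is the canonical orthonormal basis of $\ell^2(G)$, and $U_g=\lambda(g)$ is the left regular representation, $U_g e_h = e_{gh}$. $\mathcal{K}$ denotes the compact operators on $\ell^2(G)$. $\mathcal{D} = \{M_f : f \in \ell^\infty(G)\}\subseteq B(\ell^2(G))$ is the algebra of diagonal (multiplication) operators, identified with $\ell^\infty(G) \equiv C(\beta G)$, where $\beta G$ is the Stone-Cech compactification of $G$; the continuous extension of $f$ to $\beta G$ is again denoted $f$. Left multiplication $g_1\mapsto g g_1$ extends to a homeomorphism of $\beta G$, written $\omega\mapsto g\cdot\omega$, giving an action of $G$ on $\beta G$. For $\omega\in\beta G$, $\pi_\omega:\mathcal{D}\to\mathcal{D}$ is the $*$-homomorphism $\pi_\omega(M_f)=M_{h}$ with $h(g)=f(g\cdot\omega)$. $\mathcal{D}\times_r G$ denotes the C*-subalgebra of $B(\ell^2(G))$ generated by $\mathcal{D}$ and $\{U_g:g\in G\}$, and $\pi_\omega\times\lambda:\mathcal{D}\times_r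 G\to B(\ell^2(G))$ is the $*$-homomorphism with $\pi_\omega\times\lambda(\sum_n M_{f_n}U_{g_n})=\sum_n\pi_\omega(M_{f_n})U_{g_n}$ for finite (or norm convergent) sums. Put $\mathcal{A}_\omega=\pi_\omega\times\lambda(\mathcal{D}\times_r G)$. $\rho_\omega:\beta G\to\beta G$ is the unique continuous map with $\rho_\omega(g)=g\cdot\omega$ for $g\in G$, and $\alpha\cdot\omega:=\rho_\omega(\alpha)$ defines an associative product on $\beta G$. The point $\omega$ is right cancellative if $\alpha\cdot\omega=\beta\cdot\omega$ (with $\alpha,\beta\in\beta G$) implies $\alpha=\beta$. The point $\omega$ is non-recurrent if there is an open neighborhood $U$ of $\omega$ in $\beta G$ such that $g\cdot\omega\notin U$ for all $g\in G$, $g\neq1$. *)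

(* Defs.v *)
From HB Require Import structures.
From mathcomp Require Import all_boot all_order all_algebra.
From mathcomp Require Import finmap complex.
From mathcomp Require Import all_classical all_reals all_analysis.
From mathcomp Require Import ring lra.
From mathcomp Require summability.
Import Order.TTheory GRing.Theory Num.Theory.
Import numFieldNormedType.Exports.
Import Normc.

Set Implicit Arguments.
Unset Strict Implicit.
Unset Printing Implicit Defensive.

Local Open Scope classical_set_scope.
Local Open Scope complex_scope.
Local Open Scope ring_scope.

Section SquareSummable.
Variables (R : realType) (I : choiceType).
Implicit Types (x y : I -> R[i]^o) (a b : R).

Definition sqsum x : \bar R :=
  (\esum_(i in [set: I]) (normc (x i) ^+ 2)%:E)%E.

Lemma sqsum_ge0 x : (0 <= sqsum x)%E.
Proof. by apply: esum_ge0 => i _; rewrite lee_fin sqr_ge0. Qed.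

Lemma sqsum_le x a : (sqsum x <= a%:E)%E <->
  forall X, finite_set X -> \sum_(i <- fset_set X) normc (x i) ^+ 2 <= a.
Proof.
split=> [xa X Xf|H].
  rewrite -lee_fin -fsbig_finite// -fsumEFin //; apply: le_trans xa.
  by apply: esum_ge; exists X => //; split.
apply: ge_ereal_sup => _ [X [Xf _] <-]; rewrite fsumEFin // lee_fin fsbig_finite//; exact: H.
Qed.

Lemma sqsum_ge x i : ((normc (x i) ^+ 2)%:E <= sqsum x)%E.
Proof. by apply: esum_ge; exists [set i]; rewrite ?fsbig_set1//; split. Qed.

Lemma sqsum_eq0 x : (sqsum x <= 0)%E -> x = 0.
Proof.
move=> x0; apply/funext => i; have := le_trans (sqsum_ge x i) x0.
by rewrite lee_fin real_exprn_even_le0 ?num_real//= => /eqP/eq0_normc.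
Qed.

Lemma sqsum0 : sqsum 0 = 0%E.
Proof. by apply: esum1 => i _; rewrite normc0 expr0n. Qed.

Lemma sqsumD x y a b : 0 <= a -> 0 <= b ->
  (sqsum x <= (a ^+ 2)%:E)%E -> (sqsum y <= (b ^+ 2)%:E)%E ->
  (sqsum (x + y)%R <= ((a + b) ^+ 2)%:E)%E.
Proof.
rewrite le_eqVlt => /predU1P[<- _ |a0].
  by rewrite expr0n/= => /sqsum_eq0 ->; rewrite !add0r.
rewrite le_eqVlt => /predU1P[<- + |b0].
  by rewrite expr0n/= => + /sqsum_eq0 ->; rewrite !addr0.
move=> /sqsum_le Hx /sqsum_le Hy; apply/sqsum_le => X Xf.
set u := fun i => normc (x i); set v := fun i => normc (y i).
have le1 i : normc ((x + y) i) ^+ 2 <=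
    (a + b) / a * u i ^+ 2 + (a + b) / b * v i ^+ 2.
  apply: (@le_trans _ _ ((u i + v i) ^+ 2)).
    rewrite ler_sqr ?nnegrE ?addr_ge0 ?le_normcD //; rewrite /u /v.
    - by rewrite -ler0c -[X in _ <= X]/(`|(x + y) i|) normr_ge0.
    - by rewrite -ler0c -[X in _ <= X]/(`|x i|) normr_ge0.
    - by rewrite -ler0c -[X in _ <= X]/(`|y i|) normr_ge0.
  rewrite -subr_ge0.
  have -> : (a + b) / a * u i ^+ 2 + (a + b) / b * v i ^+ 2 - (u i + v i) ^+ 2
     = (b * u i - a * v i) ^+ 2 / (a * b) by field; rewrite !gt_eqF.
  by rewrite divr_ge0 ?sqr_ge0 ?mulr_ge0 ?ltW.
apply: (@le_trans _ _ (\sum_(i <- fset_set X) ((a + b) / a * u i ^+ 2 + (a + b) / b * v i ^+ 2))).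
  by apply: ler_sum.
rewrite big_split/= -!mulr_sumr.
have -> : (a + b) ^+ 2 = (a + b) / a * a ^+ 2 + (a + b) / b * b ^+ 2.
  by field; rewrite !gt_eqF.
have ab0 : 0 <= a + b by rewrite addr_ge0// ltW.
apply: lerD; apply: ler_wpM2l; by [apply: divr_ge0 => //; exact: ltW|exact: Hx|exact: Hy].
Qed.

Lemma sqsumZ (c : R[i]) x a : (sqsum x <= (a ^+ 2)%:E)%E ->
  (sqsum (c *: x)%R <= ((normc c * a) ^+ 2)%:E)%E.
Proof.
move=> /sqsum_le Hx; apply/sqsum_le => X Xf; rewrite exprMn.
under eq_bigr do rewrite -[(c *: x) _]/(c * x _) normcM exprMn.
by rewrite -mulr_sumr; apply: ler_wpM2l; [exact: sqr_ge0|exact: Hx].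
Qed.
End SquareSummable.

Section l2.
Variables (R : realType) (I : choiceType).

Definition l2_pred : {pred I -> R[i]^o} := fun x => `[< (sqsum x < +oo)%E >].

Record l2 := L2 { l2_fun :> I -> R[i]^o ; l2_fin : l2_fun \in l2_pred }.

HB.instance Definition _ := [isSub for l2_fun].
HB.instance Definition _ := [Choice of l2 by <:].

Lemma l2_predP x :
  (exists2 a : R, 0 <= a & (sqsum x <= (a ^+ 2)%:E)%E) <-> x \in l2_pred.
Proof.
split=> [[a a0 xa]|/asboolP].
  by apply/asboolP; apply: le_lt_trans xa (ltry _).
have := sqsum_ge0 x; case E : (sqsum x) => [s| |]//; rewrite lee_fin => s0 _.
by exists (Num.sqrt s); rewrite ?sqrtr_ge0// sqr_sqrtr.
Qed.

Fact l2_submod_closed : submod_closed l2_pred.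
Proof.
split; first by apply/l2_predP; exists 0; rewrite // sqsum0 expr0n.
move=> c x y /l2_predP[a a0 xa] /l2_predP[b b0 yb]; apply/l2_predP.
have c0 : 0 <= normc c by rewrite -ler0c -[X in _ <= X]/(`|c|).
exists (normc c * a + b); first by rewrite addr_ge0// mulr_ge0.
by apply: sqsumD => //; [rewrite mulr_ge0|exact: sqsumZ].
Qed.
HB.instance Definition _ :=
  GRing.isSubmodClosed.Build _ _ l2_pred l2_submod_closed.
HB.instance Definition _ := [SubChoice_isSubLmodule of l2 by <:].

(* The norm of a normedModType over R[i] takes its values in R[i]. *)
Definition l2norm (x : l2) : R[i] := (Num.sqrt (fine (sqsum x)))%:C.

Lemma l2normP (x : l2) : (sqsum x <= (Num.sqrt (fine (sqsum x)) ^+ 2)%:E)%E.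
Proof.
rewrite sqr_sqrtr ?fine_ge0 ?sqsum_ge0// fineK// ge0_fin_numE ?sqsum_ge0//.
by have /asboolP := l2_fin x.
Qed.

Lemma l2norm_le (x : l2) (a : R) : 0 <= a -> (sqsum x <= (a ^+ 2)%:E)%E -> l2norm x <= a%:C.
Proof.
move=> a0 xa; rewrite lecR -[leRHS]ger0_norm// -sqrtr_sqr; apply: ler_wsqrtr.
rewrite -lee_fin fineK// ge0_fin_numE ?sqsum_ge0//.
by have /asboolP := l2_fin x.
Qed.

Lemma l2normD x y : l2norm (x + y) <= l2norm x + l2norm y.
Proof.
have -> : l2norm x + l2norm y =
  (Num.sqrt (fine (sqsum x)) + Num.sqrt (fine (sqsum y)))%:C.
  by rewrite [RHS](rmorphD (real_complex R)).
apply: l2norm_le; first by rewrite addr_ge0 ?sqrtr_ge0.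
by apply: sqsumD; rewrite ?sqrtr_ge0 ?l2normP.
Qed.

Lemma l2norm0 x : l2norm x = 0 -> x = 0.
Proof.
move=> [x0]; apply/val_inj/sqsum_eq0.
by have := l2normP x; rewrite x0 expr0n.
Qed.

Lemma l2normZ (c : R[i]) x : l2norm (c *: x) = `|c| * l2norm x.
Proof.
have le (d : R[i]) z : l2norm (d *: z) <= `|d| * l2norm z.
  have -> : `|d| * l2norm z = (normc d * Num.sqrt (fine (sqsum z)))%:C.
    by rewrite [RHS](rmorphM (real_complex R)).
  apply: l2norm_le; last exact/sqsumZ/l2normP.
  by rewrite mulr_ge0 ?sqrtr_ge0// -ler0c -[X in _ <= X]/(`|d|).
apply/eqP; rewrite eq_le le/=.
have [->|c0] := eqVneq c 0.
  by rewrite normr0 mul0r ler0c sqrtr_ge0.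
rewrite -ler_pdivlMl ?normr_gt0// -normfV.
by rewrite -[in leLHS](scalerK c0 x); exact: le.
Qed.

HB.instance Definition _ :=
  Lmodule_isNormed.Build R[i] l2 l2normD l2normZ l2norm0.

End l2.

Section Operators.
Variables (R : realType) (V : normedModType R[i]).
Implicit Types T S : V -> V.

Definition bounded_ops : set (V -> V) := [set T | linear T /\ continuous T].

Definition compact_ops : set (V -> V) :=
  [set T | bounded_ops T /\ compact (closure (T @` [set x | `|x| <= 1]))].

Definition opnorm_le T (c : R[i]) := forall x, `|T x| <= c * `|x|.

End Operators.
Arguments bounded_ops {R V}.
Arguments compact_ops {R V}.

Section L2Operators.
Variables (R : realType) (I : choiceType).
Local Notation H := (l2 R I).
Implicit Types (x y : H) (T S : H -> H) (A : set (H -> H)).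

(* Limit of the net of finite partial sums; conjugate-linear in [y]. *)
Definition l2dot x y : R[i]^o :=
  summability.sum (fun i => x i * (y i)^* : R[i]^o).

Definition is_adjoint T S := forall x y, l2dot (T x) y = l2dot x (S y).

(* C*-subalgebras of the bounded operators, as sets of maps: norm-closed
   complex subspaces, stable under composition and adjoints. *)
Definition cstar_subalgebra A :=
  [/\ A `<=` bounded_ops,
      A 0 /\ (forall (c : R[i]) T S, A T -> A S -> A (c *: T + S)),
      forall T S, A T -> A S -> A (T \o S),
      forall T S, A T -> bounded_ops S -> is_adjoint T S -> A S
    & forall T, bounded_ops T ->
        (forall e, 0 < e -> exists2 S, A S & opnorm_le (T - S) e) -> A T].

(* [to_l2 f] is [f] if [f] is square-summable and the junk value 0 otherwise;
   the junk value is never reached below, by [l2deltaE], [mulopE], [lregE]. *)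
Definition to_l2 (f : I -> R[i]^o) : H := insubd 0 f.

Definition l2delta (i : I) : H := to_l2 (fun j => (j == i)%:R).

Definition linfty : set (I -> R[i]^o) :=
  [set f | exists M : R[i], forall i, `|f i| <= M].

(* The multiplication operator M_f, meaningful for [f] in [linfty]. *)
Definition mulop (f : I -> R[i]^o) : H -> H :=
  fun x => to_l2 (fun i => f i * x i).

Definition diag_ops : set (H -> H) := mulop @` linfty.

(* Recovers f from M_f: see [diag_coefE]. *)
Definition diag_coef T : I -> R[i]^o := fun i => T (l2delta i) i.

Lemma to_l2E f : f \in l2_pred (R := R) (I := I) -> to_l2 f = f :> (I -> _).
Proof. by move=> fP; rewrite /to_l2 /= val_insubd fP. Qed.

Lemma l2deltaE i j : l2delta i j = (j == i)%:R.
Proof.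
rewrite /l2delta to_l2E//; apply/l2_predP; exists 1 => //.
rewrite expr1n; apply/sqsum_le => X Xf.
apply: (@le_trans _ _ (\sum_(k <- fset_set X | k == i) 1)).
  rewrite [leRHS]big_mkcond/=; apply: ler_sum => k _.
  by case: ifP => _; rewrite ?normc1 ?normc0 ?expr1n ?expr0n.
rewrite -big_filter big_const_seq count_predT.
have : (size [seq k <- fset_set X | k == i] <= 1)%N.
  by rewrite size_filter count_uniq_mem// leq_b1.
by case: size => [|[|]]//= _; rewrite addr0.
Qed.

Lemma mulopE f x i : linfty f -> mulop f x i = f i * x i.
Proof.
move=> [M fM]; rewrite /mulop to_l2E//; apply/l2_predP.
have /l2_predP[a a0 xa] := l2_fin x.
have M0 : 0 <= M by exact: le_trans (fM i).
have MR : M = (complex.Re M)%:C by rewrite RRe_real// ger0_real.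
have RM0 : 0 <= complex.Re M by rewrite -ler0c -MR.
have fMR j : normc (f j) <= complex.Re M.
  by rewrite -lecR -MR; exact: fM.
have n0 (z : R[i]) : 0 <= normc z by rewrite -ler0c -[X in _ <= X]/(`|z|).
exists (complex.Re M * a); first by rewrite mulr_ge0.
apply/sqsum_le => X Xf; rewrite exprMn.
move/sqsum_le/(_ X Xf) : xa => xa.
apply: (le_trans _ (ler_wpM2l (sqr_ge0 (complex.Re M)) xa)); rewrite mulr_sumr.
apply: ler_sum => j _; rewrite normcM exprMn ler_wpM2r ?sqr_ge0//.
by rewrite ler_sqr ?nnegrE.
Qed.

Lemma diag_coefE f : linfty f -> diag_coef (mulop f) = f.
Proof.
move=> fb; apply/funext => i.
by rewrite /diag_coef mulopE// l2deltaE eqxx mulr1.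
Qed.

End L2Operators.

Section StoneCech.
Variables (G : Type) (bG : topologicalType) (iota : G -> bG).

(* [iota] is a Stone-Cech compactification of the discrete space G; as G is
   discrete, every map out of it is continuous. Uniqueness of the continuous
   extension F follows from the density of the range of [iota]. *)
Definition stone_cech :=
  [/\ compact [set: bG], hausdorff_space bG, dense (range iota)
    & forall (K : topologicalType) (f : G -> K),
        compact [set: K] -> hausdorff_space K ->
        exists2 F : bG -> K, continuous F & F \o iota = f].

End StoneCech.

Section Dynamics.
Variables (R : realType) (G : groupType) (bG : topologicalType).
Variables (iota : G -> bG) (omega : bG).
Local Notation H := (l2 R G).

(* The continuous extension of [f] along [iota]; the constant map is a junk value
   used when there is none, e.g. for an unbounded complex function. *)
Definition ext (K : topologicalType) (f : G -> K) : bG -> K :=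
  xget (fun=> f 1%g) [set F | continuous F /\ F \o iota = f].

(* The action omega |-> g . omega of G on bG. *)
Definition act (g : G) : bG -> bG := ext (fun h => iota (g * h)%g).

(* rho_w, the continuous extension of g |-> g . w. *)
Definition rtrans (w : bG) : bG -> bG := ext (fun g => act g w).

Definition sc_mul (a w : bG) : bG := rtrans w a.

Definition non_recurrent :=
  exists U : set bG,
    [/\ open U, U omega & forall g : G, g <> 1%g -> ~ U (act g omega)].

Definition right_cancellative :=
  forall a b : bG, sc_mul a omega = sc_mul b omega -> a = b.

(* The left regular representation: U_g e_h = e_(gh), see [lreg_delta]. *)
Definition lreg (g : G) : H -> H :=
  fun x => to_l2 (fun h => x (g^-1 * h)%g).

Definition pull (f : G -> R[i]^o) : G -> R[i]^o := fun g => ext f (act g omega).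

(* pi_omega, as a map on diagonal operators: pi_omega (M_f) = M_(pull f) by
   [pi_opE]; its values outside [diag_ops] are irrelevant. A bounded [f] extends to
   the compact space bG, so [pull f] is bounded as well. *)
Definition pi_op (T : H -> H) : H -> H := mulop (pull (diag_coef T)).

(* The reduced crossed product D x_r G, as a C*-algebra of operators. *)
Definition crossed : set (H -> H) :=
  smallest (@cstar_subalgebra R G) (@diag_ops R G `|` range lreg).

(* [Phi] restricts to the *-homomorphism pi_omega x lambda on [crossed].
   Contractivity is automatic for *-homomorphisms of C*-algebras; it is listed
   because it is what extends the formula for
   Phi (\sum_n M_(f_n) U_(g_n)) from finite to norm-convergent sums, and hence
   makes Phi unique on [crossed]. *)
Definition is_pi_lambda (Phi : (H -> H) -> (H -> H)) :=
  [/\ forall T, crossed T -> bounded_ops (Phi T),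
      forall (c : R[i]) T S, crossed T -> crossed S ->
        Phi (c *: T + S) = c *: Phi T + Phi S,
      forall T S, crossed T -> crossed S -> Phi (T \o S) = Phi T \o Phi S,
      forall T S, crossed T -> crossed S -> is_adjoint T S ->
        is_adjoint (Phi T) (Phi S)
    & (forall T c, crossed T -> opnorm_le T c -> opnorm_le (Phi T) c) /\
      (forall f g, linfty f ->
        Phi (mulop f \o lreg g) = pi_op (mulop f) \o lreg g)].

(* The *-homomorphism pi_omega x lambda, by definite description; its values
   outside [crossed] are irrelevant. *)
Definition pi_lambda : (H -> H) -> (H -> H) :=
  xget (id : (H -> H) -> (H -> H)) is_pi_lambda.

Definition A_omega : set (H -> H) := pi_lambda @` crossed.

Lemma lregE g x h : lreg g x h = x (g^-1 * h)%g.
Proof.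
rewrite /lreg to_l2E//; apply/asboolP.
have /asboolP := l2_fin x; rewrite /sqsum => xfin.
rewrite -(@reindex_esum R G G setT setT (fun h => g^-1 * h)%g
  (fun h => (normc (x h) ^+ 2)%:E))//.
split=> //.
  by move=> a b _ _; exact: mulgI.
by move=> a _; exists (g * a)%g; rewrite ?mulKg.
Qed.

Lemma lreg_delta g h : lreg g (l2delta R h) = l2delta R (g * h)%g.
Proof.
apply/val_inj/funext => k; rewrite /= lregE !l2deltaE; congr (_%:R).
by congr nat_of_bool; apply/eqP/eqP => [<-|->]; rewrite (mulVKg, mulKg).
Qed.

Lemma pi_opE f : linfty f -> pi_op (mulop f) = mulop (pull f).
Proof. by move=> fb; rewrite /pi_op diag_coefE. Qed.

End Dynamics.

Definition no_finite_subgroups (G : groupType) :=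
  forall S : {pred G}, group_closed S -> finite_set [set` S] ->
    forall g, g \in S -> g = 1%g.

Arguments diag_ops R I : clear implicits.
Arguments crossed R G : clear implicits.
Arguments pi_op {R G bG} iota omega T.
Arguments A_omega R {G bG} iota omega.

(* Main.v *)
Require Import Defs.
From HB Require Import structures.
From mathcomp Require Import all_boot all_order all_algebra.
From mathcomp Require Import finmap complex.
From mathcomp Require Import all_classical all_reals all_analysis.
From mathcomp Require Import ring.
From mathcomp Require summability.
Import Order.TTheory GRing.Theory Num.Theory.
Import numFieldNormedType.Exports.
Import Normc.

(**
Write [T(k,h)] for the matrix entries of a bounded operator [T] on l2(G), and
identify a bounded function on G with its continuous extension to the
Stone-Cech compactification.  Everything rests on a formula for the
representation attached to omega, valid for every bounded [T]:

   [wlim T (k,h)] = the value at omega of the bounded function j |-> T(kj,hj).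

In other words [wlim T] is the weak limit, along j -> omega, of the
conjugates of [T] by the right translations.  It is linear, contractive and
compatible with adjoints, and it sends [M_f U_g] to [M_(pull f) U_g].  The
finite sums of operators [M_f U_g] are norm dense in the crossed product
([fourier_dense]), whence [wlim] is multiplicative there ([wlim_comp]) and is
the only map with the properties required of the representation
([is_pi_lambda_unique]).  So the algebra attached to omega is the image of the
crossed product under [wlim] ([A_omegaE]), and questions about it become
questions about the functions g |-> F(g.omega) with F continuous.

Non-recurrence implies that the algebra is the whole crossed product.  As G is
countable, the points g.omega have neighbourhoods whose traces on G are
pairwise disjoint; this gives a partial map kappa from G to G such that kappa(kj) = k as
soon as j is close enough to omega, how close depending on k
([non_recurrent_block_map]).  For each j the elements kj with kappa(kj) = k
form a block, and distinct blocks are disjoint.  Copying the compression of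
[T] into every block produces a contractive linear right inverse [block_sum]
of [wlim] ([wlim_block_sum]); being contractive and preserving finite Fourier
sums, it preserves the crossed product.

From there, compact operators lie in the crossed product ([compact_crossed]),
so they lie in the algebra, which then contains the nonzero projection onto a
basis vector.  Conversely let [T] be a nonzero compact operator in the
algebra.  Each of its diagonals k |-> T(k, gk) has the form k |-> F(k.omega)
with F continuous, and tends to 0 at infinity since [T] is compact.  If F is
nonzero at k.omega, then only finitely many translates of omega enter some
neighbourhood of it.  In particular the stabilizer of omega is a finite
subgroup, hence trivial, and removing the finitely many other translates from
the neighbourhood shows that omega is non-recurrent
([compact_meets_non_recurrent]).

The remaining conditions are compared with these by reading off main
diagonals.  If the algebra is everything, the diagonal of a preimage of [M_f]
is a preimage of [M_f] under [pi_op].  If [pi_op] is onto, every bounded f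
satisfies f = pull d for some d, and ext (pull d) factors through [rtrans], so
[rtrans] separates points.  If [rtrans] is injective, the complement of the
isolated point 1 has a compact image that misses omega and contains all
g.omega with g <> 1; the complement of that image witnesses non-recurrence.
*)

Set Implicit Arguments.
Unset Strict Implicit.
Unset Printing Implicit Defensive.
Local Open Scope classical_set_scope.
Local Open Scope complex_scope.
Local Open Scope ring_scope.

(** * Square-summable families and coordinate projections *)

Section SquareSummableNorm.
Variables (R : realType) (I : choiceType).
Local Notation C := R[i].
Local Notation H := (l2 R I).
Implicit Types (x y z : H) (X Y : {fset I}) (c e : C).

Lemma ge0_real_complex c : 0 <= c -> exists2 a : R, 0 <= a & c = a%:C.
Proof.
move=> c0; exists (complex.Re c); first by rewrite -lecR RRe_real// ger0_real.
by rewrite RRe_real// ger0_real.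
Qed.

Lemma sum_normc2 (f : I -> C^o) X :
  (\sum_(i <- X) normc (f i) ^+ 2)%:C = \sum_(i <- X) `|f i| ^+ 2 :> C.
Proof.
rewrite [LHS](rmorph_sum (real_complex R)); apply: eq_bigr => i _.
by rewrite [LHS](rmorphXn (real_complex R)).
Qed.

Lemma sqsum_fsetP (f : I -> C^o) (a : R) : (sqsum f <= (a ^+ 2)%:E)%E <->
  forall X, \sum_(i <- X) `|f i| ^+ 2 <= a%:C ^+ 2 :> C.
Proof.
have E : a%:C ^+ 2 = (a ^+ 2)%:C :> C by rewrite [RHS](rmorphXn (real_complex R)).
split=> [/sqsum_le fa X|fa].
  by rewrite -sum_normc2 E lecR -[X]set_fsetK; apply: fa; exact: finite_fset.
by apply/sqsum_le => X Xf; rewrite -lecR sum_normc2 -E.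
Qed.

Lemma l2_predI (f : I -> C^o) c : 0 <= c ->
  (forall X, \sum_(i <- X) `|f i| ^+ 2 <= c ^+ 2) -> f \in @l2_pred R I.
Proof.
move=> /ge0_real_complex[a a0 ->] fc; apply/l2_predP.
by exists a => //; apply/sqsum_fsetP.
Qed.

Lemma l2_norm_le x c : 0 <= c ->
  (forall X, \sum_(i <- X) `|x i| ^+ 2 <= c ^+ 2) -> `|x| <= c.
Proof.
move=> /ge0_real_complex[a a0 ->] fc; rewrite -[ `|x| ]/(l2norm x).
by apply: l2norm_le => //; apply/sqsum_fsetP.
Qed.

Lemma fsum_le_norm2 x X : \sum_(i <- X) `|x i| ^+ 2 <= `|x| ^+ 2.
Proof.
rewrite -[ `|x| ]/(l2norm x).
have /sqsum_fsetP := l2normP x; exact.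
Qed.

Lemma sqsum_norm x : exists2 a : R, 0 <= a & `|x| = a%:C /\ sqsum x = (a ^+ 2)%:E.
Proof.
exists (Num.sqrt (fine (sqsum x))); first exact: sqrtr_ge0.
split=> //; rewrite sqr_sqrtr ?fine_ge0 ?sqsum_ge0// fineK//.
by rewrite ge0_fin_numE ?sqsum_ge0//; have /asboolP := l2_fin x.
Qed.

Lemma l2_coord_le x i : `|x i| <= `|x|.
Proof.
have := fsum_le_norm2 x [fset i]%fset.
by rewrite big_seq_fset1 ler_sqr ?nnegrE ?normr_ge0.
Qed.

Definition fproj X : H -> H := mulop (fun i => (i \in X)%:R).

Lemma linfty_indic (P : pred I) : linfty (fun i => (P i)%:R : C^o).
Proof. by exists 1 => i; case: (P i); rewrite ?normr1 ?normr0. Qed.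

Lemma fprojE X x i : fproj X x i = if i \in X then x i else 0.
Proof.
rewrite /fproj mulopE; last exact: (linfty_indic (fun i => i \in X)).
by case: ifP => _; rewrite ?mul1r ?mul0r.
Qed.

Lemma l2D x y i : (x + y) i = x i + y i. Proof. by []. Qed.
Lemma l2B x y i : (x - y) i = x i - y i. Proof. by []. Qed.
Lemma l2Z c x i : (c *: x) i = c * x i. Proof. by []. Qed.
Lemma l2P x y : (forall i, x i = y i) -> x = y.
Proof. by move=> xy; apply/val_inj/funext. Qed.
Lemma l2_sum (J : Type) (r : seq J) (F : J -> H) i : (\sum_(j <- r) F j) i = \sum_(j <- r) F j i.
Proof. by elim/big_rec2: _ => [|j a b _ <-]. Qed.

(** The norm is a supremum of finite partial sums; monotonicity turns the
approximation into a statement about all larger index sets. *)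
Lemma fsum_norm2_adherent x e : 0 < e -> exists X, forall Y, (X `<=` Y)%fset ->
  `|x| ^+ 2 - e <= \sum_(i <- Y) `|x i| ^+ 2.
Proof.
move=> e0; have [d d0 ed] := ge0_real_complex (ltW e0).
have {}d0 : 0 < d by move: e0; rewrite ed ltcR.
have [a a0 [xa sa]] := sqsum_norm x.
have fs : sqsum x \is a fin_num by rewrite sa.
have [_ [X0 [Xf _] <-]] := ub_ereal_sup_adherent d0 fs.
rewrite -/(esum _ _) -/(sqsum x) sa fsumEFin// fsbig_finite// -EFinD lte_fin => lt.
exists (fset_set X0) => Y XY.
have le1 : \sum_(i <- fset_set X0) `|x i| ^+ 2 <= \sum_(i <- Y) `|x i| ^+ 2.
  rewrite [leRHS](big_fsetID _ (mem (fset_set X0)))/=.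
  have -> : [fset x0 in Y | x0 \in fset_set X0]%fset = fset_set X0.
    apply/fsetP => i; rewrite !inE/=; apply/andP/idP => [[]//|iX]; split=> //.
    exact: (fsubsetP XY).
  by rewrite lerDl; apply: sumr_ge0 => i _; rewrite exprn_ge0.
apply: le_trans le1; rewrite -sum_normc2 xa ed.
have -> : a%:C ^+ 2 = (a ^+ 2)%:C :> C by rewrite [RHS](rmorphXn (real_complex R)).
rewrite -[leLHS](rmorphB (real_complex R)) lecR; exact: ltW.
Qed.

Lemma fproj_tail x e : 0 < e -> exists X, forall Y, (X `<=` Y)%fset -> `|x - fproj Y x| <= e.
Proof.
move=> e0; have [X HX] := fsum_norm2_adherent x (exprn_gt0 2 e0).
exists X => Y /HX {X HX}HY; apply: l2_norm_le => [|Z]; first exact: ltW.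
have E i : (x - fproj Y x) i = if i \in Y then 0 else x i.
  by rewrite l2B fprojE; case: ifP; rewrite ?subrr ?subr0.
have -> : \sum_(i <- Z) `|(x - fproj Y x) i| ^+ 2
   = \sum_(i <- [fset i in (Z `|` Y)%fset | i \notin Y]%fset) `|x i| ^+ 2.
  under eq_bigr do rewrite E.
  rewrite (big_fsetID _ (mem Y))/= big_seq big1 ?add0r; last first.
    by move=> i; rewrite !inE/= => /andP[_ ->]; rewrite normr0 expr0n.
  have -> : [fset x0 in Z | x0 \notin Y]%fset = [fset i in (Z `|` Y)%fset | i \notin Y]%fset.
    by apply/fsetP => i; rewrite !inE/=; case: (i \in Y); rewrite ?andbF ?orbF.
  by apply: eq_big_seq => i; rewrite !inE => /andP[_ /negbTE ->].
have := fsum_le_norm2 x (Z `|` Y)%fset.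
rewrite (big_fsetID _ (mem Y))/=.
have -> : [fset x0 in (Z `|` Y)%fset | x0 \in Y]%fset = Y.
  by apply/fsetP => i; rewrite !inE/=; case: (i \in Y); rewrite ?andbF ?orbT.
rewrite -lerBrDl => /le_trans; apply.
by rewrite lerBlDr -lerBlDl.
Qed.

Lemma fsum_delta (a : I -> C) X j :
  (\sum_(i <- X) a i *: l2delta R i : H) j = if j \in X then a j else 0.
Proof.
rewrite l2_sum; under eq_bigr do rewrite l2Z l2deltaE.
case: ifPn => jX.
  rewrite (big_fsetD1 j)//= eqxx mulr1 big_seq big1 ?addr0// => i.
  by rewrite !inE => /andP[ij _]; rewrite eq_sym (negbTE ij) mulr0.
rewrite big_seq big1// => i iX; case: eqP => [ji|]; last by rewrite mulr0.
by rewrite ji iX in jX.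
Qed.

Lemma fprojEsum X x : fproj X x = \sum_(i <- X) x i *: l2delta R i.
Proof. by apply: l2P => j; rewrite fprojE (fsum_delta x). Qed.

(** Finite combinations of basis vectors are dense, by [fproj_tail].  This is how
identities between operators or functionals get reduced to matrix entries; the
target is arbitrary so as to cover both cases. *)
Lemma l2_linear_vanish (V : normedModType C) (f : H -> V) c : 0 <= c ->
    (forall a x y, f (a *: x + y) = a *: f x + f y) ->
    (forall x, `|f x| <= c * `|x|) -> (forall i, f (l2delta R i) = 0) ->
  forall x, f x = 0.
Proof.
move=> c0 flin fc f0 x; have fz : f 0 = 0.
  by apply/eqP; rewrite -normr_le0; apply: le_trans (fc 0) _; rewrite normr0 mulr0.
have fP X : f (fproj X x) = 0.
  rewrite fprojEsum; elim/big_rec: _ => // i y _ fy.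
  by rewrite flin f0 fy scaler0 addr0.
have fD X : f x = f (x - fproj X x).
  have -> : x - fproj X x = (-1) *: fproj X x + x by rewrite scaleN1r addrC.
  by rewrite flin fP scaler0 add0r.
apply/eqP; rewrite -normr_le0; apply/ler_addgt0Pl => e e0; rewrite addr0.
have c1 : 0 < c + 1 by rewrite ltr_wpDl.
have [X /(_ X (fsubset_refl X)) HX] := fproj_tail x (divr_gt0 e0 c1).
rewrite (fD X); apply: le_trans (fc _) _.
apply: le_trans (ler_wpM2l c0 HX) _.
by rewrite mulrCA ger_pMr// ler_pdivrMr// mul1r lerDl.
Qed.

End SquareSummableNorm.

(** * The inner product *)

Section Inner.
Variables (R : realType) (I : choiceType).
Local Notation C := R[i].
Local Notation H := (l2 R I).
Implicit Types (x y z : H) (X Y : {fset I}) (c e : C).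
Import summability.
Local Existing Instance totally_filter.

Lemma partial_sumE (f : I -> C^o) X : partial_sum f X = \sum_(i <- X) f i.
Proof. by rewrite /partial_sum big_seq_fsetE. Qed.

Lemma norm2_cvg x : partial_sum (fun i => `|x i| ^+ 2 : C^o) A @[A --> totally] --> (`|x| ^+ 2
  : C^o).
Proof.
apply/cvgrPdist_le => e e0; have [X HX] := fsum_norm2_adherent x e0.
exists X => // Y /HX {}HX; rewrite partial_sumE.
have le1 := fsum_le_norm2 x Y.
by rewrite ger0_norm ?subr_ge0// lerBlDr -lerBlDl.
Qed.

Lemma normCD_normCB (a b : C) : `|a + b| ^+ 2 - `|a - b| ^+ 2 = (a * b^* + b * a^*) *+ 2.
Proof. by rewrite !normCK rmorphD rmorphB; ring. Qed.

Lemma polarization (a b : C) : a * b^* = 4^-1 *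
  ((`|a + b| ^+ 2 - `|a - b| ^+ 2) + 'i * (`|a + 'i * b| ^+ 2 - `|a - 'i * b| ^+ 2)).
Proof.
rewrite !normCD_normCB rmorphM/= conjCi.
have -> : 'i * ((a * (- 'i * b^*) + 'i * b * a^*) *+ 2) =
  - 'i ^+ 2 * (a * b^* - b * a^*) *+ 2 :> C.
  by ring.
by rewrite sqrCi; field.
Qed.

(** Polarization writes the partial sums of the inner product as combinations of
partial sums of four series with nonnegative terms, whose convergence is
[norm2_cvg]. *)
Lemma l2dot_cvg x y : partial_sum (fun i => x i * (y i)^* : C^o) A @[A --> totally] --> l2dot x y.
Proof.
suff /cvgP : partial_sum (fun i => x i * (y i)^* : C^o) A @[A --> totally] -->
   (4^-1 * ((`|x + y| ^+ 2 - `|x - y| ^+ 2) + 'i * (`|x +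
     'i *: y| ^+ 2 - `|x - 'i *: y| ^+ 2)) : C^o).
  by move=> /(_ _ _); rewrite /l2dot/sum; exact.
have -> : partial_sum (fun i => x i * (y i)^* : C^o) = fun A => (4^-1 * (
   (partial_sum (fun i => `|(x +
     y) i| ^+ 2 : C^o) A - partial_sum (fun i => `|(x - y) i| ^+ 2 : C^o) A)
   + 'i * (partial_sum (fun i => `|(x +
     'i *: y) i| ^+ 2 : C^o) A - partial_sum (fun i => `|(x - 'i *: y) i| ^+ 2 : C^o) A)) : C^o).
  apply/funext => A; rewrite !partial_sumE -!sumrB mulr_sumr -big_split mulr_sumr.
  by apply: eq_bigr => i _; rewrite !(l2D,l2B,l2Z) polarization.
apply: cvgMr; apply: cvgD.
  by apply: cvgB; exact: norm2_cvg.
by apply: cvgMr; apply: cvgB; exact: norm2_cvg.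
Qed.

Lemma l2dot_unique x y (l : C^o) :
  partial_sum (fun i => x i * (y i)^* : C^o) A @[A --> totally] --> l -> l2dot x y = l.
Proof. by move=> cl; apply: (cvg_unique _ (@l2dot_cvg x y) cl); exact: norm_hausdorff. Qed.

Lemma l2dot_lin a x y z : l2dot (a *: x + y) z = a * l2dot x z + l2dot y z.
Proof.
apply: l2dot_unique.
have -> : partial_sum (fun i => (a *: x + y) i * (z i)^* : C^o) = fun A =>
  (a * partial_sum (fun i => x i * (z i)^* : C^o) A +
    partial_sum (fun i => y i * (z i)^* : C^o) A : C^o).
  apply/funext => A; rewrite !partial_sumE mulr_sumr -big_split; apply: eq_bigr => i _.
  by rewrite l2D l2Z/= mulrDl mulrA.
by apply: cvgD; [apply: cvgMr|]; exact: l2dot_cvg.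
Qed.

Lemma l2dotC x y : l2dot y x = (l2dot x y)^*.
Proof.
apply: l2dot_unique.
have -> : partial_sum (fun i => y i * (x i)^* : C^o) = fun A =>
  ((partial_sum (fun i => x i * (y i)^* : C^o) A)^* : C^o).
  apply/funext => A; rewrite !partial_sumE rmorph_sum; apply: eq_bigr => i _.
  by rewrite rmorphM/= conjCK mulrC.
apply/cvgrPdist_le => e e0; have /cvgrPdist_le/(_ e e0) := @l2dot_cvg x y.
by apply: filterS => A; rewrite -rmorphB norm_conjC.
Qed.

Lemma l2dotxx x : l2dot x x = `|x| ^+ 2.
Proof.
apply: l2dot_unique.
have -> : (fun i => x i * (x i)^* : C^o) = fun i => (`|x i| ^+ 2 : C^o).
  by apply/funext => i; rewrite normCK.
exact: norm2_cvg.
Qed.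

Lemma l2dot_delta x i : l2dot x (l2delta R i) = x i.
Proof.
apply: l2dot_unique; apply/cvgrPdist_le => e e0; exists [fset i]%fset => // Y /= iY.
rewrite partial_sumE (big_fsetD1 i) ?(fsubsetP iY) ?inE//= l2deltaE eqxx conjC1 mulr1.
rewrite big_seq big1 ?addr0 ?subrr ?normr0 ?ltW// => j.
by rewrite !inE l2deltaE => /andP[/negbTE-> _]; rewrite conjC0 mulr0.
Qed.

Lemma l2delta_dot x i : l2dot (l2delta R i) x = (x i)^*.
Proof. by rewrite l2dotC l2dot_delta. Qed.

Lemma l2dot_linr a x y z : l2dot z (a *: x + y) = a^* * l2dot z x + l2dot z y.
Proof. by rewrite l2dotC l2dot_lin rmorphD rmorphM/= -!l2dotC. Qed.

Lemma l2dot0 y : l2dot 0 y = 0.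
Proof. by have := l2dot_lin (-1) 0 0 y; rewrite scaler0 addr0 mulN1r addNr. Qed.

Lemma l2dotDl x y z : l2dot (x + y) z = l2dot x z + l2dot y z.
Proof. by have := l2dot_lin 1 x y z; rewrite scale1r mul1r. Qed.

Lemma l2dotDr x y z : l2dot z (x + y) = l2dot z x + l2dot z y.
Proof. by rewrite l2dotC l2dotDl rmorphD/= -!l2dotC. Qed.

Lemma l2dotBl x y z : l2dot (x - y) z = l2dot x z - l2dot y z.
Proof. by rewrite addrC -scaleN1r l2dot_lin mulN1r addrC. Qed.

Lemma l2dotBr x y z : l2dot z (x - y) = l2dot z x - l2dot z y.
Proof. by rewrite l2dotC l2dotBl rmorphB/= -!l2dotC. Qed.

Lemma l2dot_suml X (F : I -> H) z : l2dot (\sum_(i <- X) F i) z = \sum_(i <- X) l2dot (F i) z.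
Proof.
elim/big_rec2: _ => [|i y w _ <-]; first exact: l2dot0.
exact: l2dotDl.
Qed.

(** The vector w = |y|^2 x - <x,y> y is orthogonal to y, and expanding the
inequality 0 <= <w,w> gives the result after division by |y|^2. *)
Lemma cauchy_schwarz x y : `|l2dot x y| <= `|x| * `|y|.
Proof.
have [->|y0] := eqVneq y 0; first by rewrite l2dotC l2dot0 conjC0 !normr0 mulr0.
have y2 : 0 < `|y| ^+ 2 by rewrite exprn_gt0 ?normr_gt0.
set p := l2dot x y.
set w := `|y| ^+ 2 *: x + (- p *: y + 0).
have wy : l2dot y w = 0.
  rewrite l2dotC /w l2dot_lin -/p (l2dot_lin (- p)) l2dot0 l2dotxx addr0 mulNr.
  by rewrite [X in _ - X]mulrC subrr conjC0.
have : l2dot w w = `|y| ^+ 2 * (`|y| ^+ 2 * `|x| ^+ 2 - `|p| ^+ 2).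
  rewrite {1}/w l2dot_lin (l2dot_lin (- p)) l2dot0 wy mulr0 !addr0; congr (_ * _).
  rewrite /w l2dot_linr (l2dot_linr (- p)) (l2dotC 0 x) l2dot0 conjC0 addr0 l2dotxx -/p.
  by rewrite geC0_conj ?exprn_ge0// rmorphN/= mulNr (mulrC _ p) normCK.
rewrite l2dotxx => w2; have := exprn_ge0 2 (normr_ge0 w).
rewrite w2 pmulr_rge0// subr_ge0 mulrC -exprMn ler_sqr ?nnegrE ?mulr_ge0 //.
Qed.
End Inner.

(** * Bounded operators *)

Section BoundedOps.
Variables (R : realType).
Local Notation C := R[i].

Lemma bounded_opsP (V : normedModType C) (T : V -> V) : bounded_ops T <->
  (forall a x y, T (a *: x + y) = a *: T x + T y) /\ exists2 c, 0 <= c & opnorm_le T c.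
Proof.
split=> [[Tl Tc]|[Tl [c c0 Tc]]].
  split; first exact: Tl.
  pose f : {linear V -> V} := HB.pack T (GRing.isLinear.Build _ _ _ _ T Tl).
  have /linear_bounded_continuous/linear_boundedP := (Tc : continuous f).
  case=> M [Mr HM].
  have M1 : M < `|M| + 1.
    by rewrite (le_lt_trans (real_ler_norm _))// ltrDl.
  by exists (`|M| + 1); [rewrite addr_ge0|move=> x; apply: HM].
split; first exact: Tl.
pose f : {linear V -> V} := HB.pack T (GRing.isLinear.Build _ _ _ _ T Tl).
apply: (linear_bounded_continuous f).1; apply/linear_boundedP.
near=> M => x; apply: le_trans (Tc x) _; apply: ler_wpM2r => //.
near: M; apply: nbhs_pinfty_ge; exact: ger0_real.
Unshelve. all: by end_near. Qed.

Section LinearRules.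
Variables (V : normedModType C) (T : V -> V).
Hypothesis bT : bounded_ops T.

Lemma bopP a x y : T (a *: x + y) = a *: T x + T y.
Proof. by have /bounded_opsP[+ _] := bT; exact. Qed.
Lemma bop0 : T 0 = 0.
Proof. by have := bopP (-1) 0 0; rewrite scaler0 addr0 scaleN1r addNr. Qed.
Lemma bopD x y : T (x + y) = T x + T y.
Proof. by have := bopP 1 x y; rewrite !scale1r. Qed.
Lemma bopZ a x : T (a *: x) = a *: T x.
Proof. by have := bopP a x 0; rewrite bop0 !addr0. Qed.
Lemma bopN x : T (- x) = - T x.
Proof. by rewrite -scaleN1r bopZ scaleN1r. Qed.
Lemma bopB x y : T (x - y) = T x - T y.
Proof. by rewrite bopD bopN. Qed.
Lemma bop_sum (J : Type) (r : seq J) (F : J -> V) : T (\sum_(j <- r) F j) = \sum_(j <- r) T (F j).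
Proof. by elim/big_rec2: _ => [|j a b _ <-]; rewrite ?bop0 ?bopD. Qed.
End LinearRules.

Section Closure.
Variable V : normedModType C.
Implicit Types T S : V -> V.

Lemma bounded_ops_lin a T S : bounded_ops T -> bounded_ops S -> bounded_ops (a *: T + S).
Proof.
move=> /bounded_opsP[Tl [c c0 Tc]] /bounded_opsP[Sl [d d0 Sd]]; apply/bounded_opsP; split.
  move=> b x y; rewrite -![(a *: T + S) _]/(a *: T _ + S _) Tl Sl !scalerDr !scalerA.
  by rewrite (mulrC a b) addrACA.
exists (`|a| * c + d); first by rewrite addr_ge0// mulr_ge0.
move=> x; rewrite -![(a *: T + S) _]/(a *: T _ + S _) mulrDl.
apply: le_trans (ler_normD _ _) _; apply: lerD => //.
by rewrite normrZ -mulrA ler_wpM2l.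
Qed.

Lemma bounded_ops0 : bounded_ops (0 : V -> V).
Proof.
apply/bounded_opsP; split; first by move=> a x y;
  rewrite -![(0 : V -> V) _]/(0 : V) scaler0 addr0.
by exists 0 => // x; rewrite -![(0 : V -> V) _]/(0 : V) normr0 mul0r.
Qed.

Lemma opnorm_le_comp T S c d : 0 <= c -> opnorm_le T c -> opnorm_le S d ->
  opnorm_le (T \o S) (c * d).
Proof.
by move=> c0 Tc Sd x; apply: le_trans (Tc _) _; rewrite -mulrA ler_wpM2l.
Qed.

Lemma bounded_ops_comp T S : bounded_ops T -> bounded_ops S -> bounded_ops (T \o S).
Proof.
move=> /bounded_opsP[Tl [c c0 Tc]] /bounded_opsP[Sl [d d0 Sd]]; apply/bounded_opsP; split.
  by move=> b x y /=; rewrite Sl Tl.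
by exists (c * d); [exact: mulr_ge0|exact: opnorm_le_comp].
Qed.

Lemma bounded_opsB T S : bounded_ops T -> bounded_ops S -> bounded_ops (T - S).
Proof.
move=> bT bS; have -> : T - S = (-1) *: S + T by rewrite scaleN1r addrC.
exact: bounded_ops_lin.
Qed.

Lemma opnorm_leD T S c d : opnorm_le T c -> opnorm_le S d -> opnorm_le (T + S) (c + d).
Proof.
move=> Tc Sd x; rewrite -![(T + S) _]/(T _ + S _) mulrDl.
by apply: le_trans (ler_normD _ _) _; apply: lerD.
Qed.

Lemma opnorm_leZ T a c : opnorm_le T c -> opnorm_le (a *: T) (`|a| * c).
Proof.
by move=> Tc x; rewrite -![(a *: T) _]/(a *: T _) normrZ -mulrA ler_wpM2l.
Qed.

Lemma opnorm_leN T c : opnorm_le T c -> opnorm_le (- T) c.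
Proof. by move=> Tc x; rewrite -[(- T) x]/(- T x) normrN. Qed.

Lemma opnorm_le_weak T c d : c <= d -> opnorm_le T c -> opnorm_le T d.
Proof. by move=> cd Tc x; apply: le_trans (Tc x) _; rewrite ler_wpM2r. Qed.
End Closure.

Section Matrix.
Variables (I : choiceType).
Local Notation H := (l2 R I).
Implicit Types (T S : H -> H) (x y z : H) (X Y : {fset I}) (c e : C).

Lemma bounded_ops_ext T S : bounded_ops T -> bounded_ops S ->
  (forall i j, T (l2delta R i) j = S (l2delta R i) j) -> T = S.
Proof.
move=> bT bS TS; apply/funext => x; apply/eqP; rewrite -subr_eq0; apply/eqP.
have /bounded_opsP[Dl [c c0 Dc]] := bounded_opsB bT bS.
apply: (l2_linear_vanish c0 Dl Dc) => i; apply/eqP; rewrite subr_eq0; apply/eqP.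
by apply: l2P => j; exact: TS.
Qed.

Lemma norm_l2delta i : `|l2delta R i : H| = 1.
Proof.
apply/eqP; rewrite -(@eqrXn2 _ 2)// expr1n -l2dotxx l2dot_delta l2deltaE.
by rewrite eqxx.
Qed.

Lemma opnorm_le_coef T c i j : opnorm_le T c -> `|T (l2delta R i) j| <= c.
Proof.
by move=> Tc; apply: le_trans (l2_coord_le _ _) _; apply: le_trans (Tc _) _;
  rewrite norm_l2delta mulr1.
Qed.

Lemma opnorm_le_ge0 T c (i : I) : opnorm_le T c -> 0 <= c.
Proof.
by move=> /(_ (l2delta R i)); rewrite norm_l2delta mulr1; exact: le_trans.
Qed.

(** Both sides of the adjunction formula are continuous, linear in the first vector
and conjugate-linear in the second, so [l2_linear_vanish] applies to one
variable after the other. *)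
Lemma is_adjointP T S : bounded_ops T -> bounded_ops S ->
  is_adjoint T S <-> forall i j, S (l2delta R i) j = (T (l2delta R j) i)^*.
Proof.
move=> bT bS; split=> [TS i j|TS x y].
  by have := TS (l2delta R j) (l2delta R i); rewrite l2dot_delta l2delta_dot => ->;
    rewrite conjCK.
have /bounded_opsP[_ [c c0 Tc]] := bT; have /bounded_opsP[_ [d d0 Sd]] := bS.
apply/eqP; rewrite -subr_eq0; apply/eqP.
pose f (x : H) : C^o := l2dot (T x) y - l2dot x (S y).
apply: (@l2_linear_vanish _ _ C^o f (c * `|y| + `|S y|)); rewrite /f => {x}.
- by rewrite addr_ge0 ?mulr_ge0.
- move=> a x1 x2; rewrite bopP// !l2dot_lin opprD addrACA -mulrBr; done.
- move=> x; apply: le_trans (ler_normB _ _) _; rewrite mulrDl; apply: lerD.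
    apply: le_trans (cauchy_schwarz _ _) _; rewrite mulrAC ler_wpM2r//.
  by rewrite mulrC cauchy_schwarz.
move=> i; rewrite l2dotC l2delta_dot -rmorphB; apply/eqP; rewrite conjC_eq0; apply/eqP.
pose g (z : H) : C^o := l2dot z (T (l2delta R i)) - S z i.
apply: (@l2_linear_vanish _ _ C^o g (`|T (l2delta R i)| + d)); rewrite /g.
- by rewrite addr_ge0.
- move=> a x1 x2; rewrite bopP// !l2dot_lin opprD addrACA -mulrBr; done.
- move=> x; apply: le_trans (ler_normB _ _) _; rewrite mulrDl; apply: lerD.
    by rewrite mulrC cauchy_schwarz.
  exact: le_trans (l2_coord_le _ _) (Sd _).
by move=> j; rewrite l2delta_dot TS subrr.
Qed.

Lemma is_adjointD T T' S S' : is_adjoint T S -> is_adjoint T' S' -> is_adjoint (T + T') (S + S').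
Proof. by move=> TS TS' x y;
  rewrite -[(T + T') x]/(T x + T' x) -[(S + S') y]/(S y + S' y) l2dotDl l2dotDr TS TS'. Qed.

Lemma is_adjointB T T' S S' : is_adjoint T S -> is_adjoint T' S' -> is_adjoint (T - T') (S - S').
Proof. by move=> TS TS' x y;
  rewrite -[(T - T') x]/(T x - T' x) -[(S - S') y]/(S y - S' y) l2dotBl l2dotBr TS TS'. Qed.

Lemma adjoint_opnorm T S c : 0 <= c -> is_adjoint T S -> opnorm_le T c -> opnorm_le S c.
Proof.
move=> c0 TS Tc x; have [->|Sx] := eqVneq (S x) 0; first by rewrite normr0 mulr_ge0.
have Sx0 : 0 < `|S x| by rewrite normr_gt0.
have : `|S x| ^+ 2 <= c * `|S x| * `|x|.
  rewrite -l2dotxx -TS; apply: le_trans (real_ler_norm _) _.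
    by rewrite TS l2dotxx realX// normr_real.
  by apply: le_trans (cauchy_schwarz _ _) _; rewrite ler_wpM2r.
by rewrite mulrAC expr2 ler_pM2r.
Qed.

End Matrix.
End BoundedOps.

(** * Multiplication operators and reindexing *)

Section MultiplicationOperators.
Variables (R : realType) (I : choiceType).
Local Notation C := R[i].
Local Notation H := (l2 R I).
Implicit Types (T S : H -> H) (x y z : H) (X Y : {fset I}) (c e : C) (f : I -> C^o).

Lemma opDE T S x : (T + S) x = T x + S x. Proof. by []. Qed.
Lemma opBE T S x : (T - S) x = T x - S x. Proof. by []. Qed.
Lemma opZE c T x : (c *: T) x = c *: T x. Proof. by []. Qed.

Lemma linfty_bound f : linfty f -> exists2 M : C, 0 <= M & forall i, `|f i| <= M.
Proof.
move=> [M fM]; have [[i _]|I0] := pselect (exists i : I, True); last first.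
  by exists 0 => // i; case: I0; exists i.
by exists M => //; exact: le_trans (fM i).
Qed.

Lemma linfty_cst c : linfty (fun _ : I => c : C^o).
Proof. by exists `|c|. Qed.

Lemma linftyM f1 f2 (k : I -> I) : linfty f1 -> linfty f2 ->
  linfty (fun i => f1 i * f2 (k i) : C^o).
Proof.
move=> /linfty_bound[M M0 f1M] [N f2N]; exists (M * N) => i.
by rewrite normrM ler_pM.
Qed.

Lemma linfty_comp f (k : I -> I) : linfty f -> linfty (f \o k).
Proof. by move=> [N f2N]; exists N => i; exact: f2N. Qed.

Lemma linftyJ f (k : I -> I) : linfty f -> linfty (fun i => (f (k i))^* : C^o).
Proof. by move=> [N f2N]; exists N => i; rewrite norm_conjC. Qed.

Lemma mulop_opnorm f c : 0 <= c -> (forall i, `|f i| <= c) -> opnorm_le (mulop f) c.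
Proof.
move=> c0 fc x; apply: l2_norm_le => [|X]; first exact: mulr_ge0.
rewrite exprMn; apply: le_trans (ler_wpM2l (exprn_ge0 2 c0) (fsum_le_norm2 x X)).
rewrite mulr_sumr; apply: ler_sum => i _; rewrite mulopE; last by exists c.
by rewrite normrM exprMn ler_wpM2r ?exprn_ge0// lerXn2r ?nnegrE.
Qed.

Lemma mulop_bounded f : linfty f -> bounded_ops (mulop f).
Proof.
move=> fb; have [c c0 fc] := linfty_bound fb; apply/bounded_opsP; split; last first.
  by exists c => //; exact: mulop_opnorm.
by move=> a x y; apply: l2P => i; rewrite l2D l2Z !mulopE// l2D l2Z mulrDr mulrCA.
Qed.

Section Reindexing.
Variable k : I -> I.
Hypothesis kI : injective k.

(** An injective reindexing turns a finite partial sum into another one.  Applied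
to left and right translations of a group, this makes the regular
representations contractive. *)
Lemma fsum_comp_le x X : \sum_(i <- X) `|x (k i)| ^+ 2 <= `|x| ^+ 2.
Proof.
apply: le_trans (fsum_le_norm2 x [fset k i | i in X]%fset).
by rewrite big_imfset//= => i j _ _; exact: kI.
Qed.

Lemma l2_comp_pred x : (fun i => x (k i)) \in @l2_pred R I.
Proof. by apply: (@l2_predI _ _ _ `|x|) => // X; exact: fsum_comp_le. Qed.

Definition l2_comp x : H := to_l2 (fun i => x (k i)).

Lemma l2_compE x i : l2_comp x i = x (k i).
Proof. by rewrite /l2_comp to_l2E// l2_comp_pred. Qed.

Lemma l2_comp_opnorm : opnorm_le l2_comp 1.
Proof.
move=> x; rewrite mul1r; apply: l2_norm_le => // X.
by under eq_bigr do rewrite l2_compE; exact: fsum_comp_le.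
Qed.

Lemma l2_comp_bounded : bounded_ops l2_comp.
Proof.
apply/bounded_opsP; split; last by exists 1 => //; exact: l2_comp_opnorm.
by move=> a x y; apply: l2P => i; rewrite l2D l2Z !l2_compE.
Qed.
End Reindexing.

Definition op_approx (F : set (H -> H)) T := forall e, 0 < e ->
  exists2 S, F S & opnorm_le (T - S) e.

(** Absorbs a constant into the precision: e/(e+1)/(K+1) is at most 1 and its
product with K is at most e. *)
Lemma op_approxK (F : set (H -> H)) T K : 0 <= K ->
  (forall e, 0 < e -> e <= 1 -> exists2 S, F S & opnorm_le (T - S) (K * e)) -> op_approx F T.
Proof.
move=> K0 HK e e0; have K1 : 0 < K + 1 by rewrite ltr_wpDl.
have d0 : 0 < e / (e + 1) / (K + 1) by rewrite !divr_gt0// addr_gt0.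
have [|S FS TS] := HK _ d0.
  rewrite ler_pdivrMr// mul1r; apply: (@le_trans _ _ 1); last by rewrite lerDr.
  by rewrite ler_pdivrMr ?addr_gt0// mul1r lerDl.
exists S => //; apply: opnorm_le_weak TS.
rewrite mulrCA; apply: (@le_trans _ _ (e / (e + 1))).
  by rewrite ger_pMr ?divr_gt0 ?addr_gt0// ler_pdivrMr// mul1r lerDl.
by rewrite ler_pdivrMr ?addr_gt0// ler_peMr ?lerDr// ltW.
Qed.

Lemma bounded_cstar : cstar_subalgebra (@bounded_ops R H).
Proof.
split=> //; first by split; [exact: bounded_ops0|move=> *; exact: bounded_ops_lin].
by move=> *; exact: bounded_ops_comp.
Qed.

End MultiplicationOperators.

(** * The crossed product as the closure of the finite Fourier sums *)

Section CrossedProduct.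
Variables (R : realType) (G : groupType).
Local Notation C := R[i].
Local Notation H := (l2 R G).
Implicit Types (T S : H -> H) (x y z : H) (c e : C) (f : G -> C^o) (g h : G).

Lemma lregE_comp g : lreg g = @l2_comp R G (fun h => g^-1 * h)%g.
Proof. by []. Qed.

Lemma mulVg_inj g : injective (fun h => g^-1 * h)%g.
Proof. exact: mulgI. Qed.

Lemma lreg_bounded g : bounded_ops (@lreg R G g).
Proof. by rewrite lregE_comp; exact/l2_comp_bounded/mulVg_inj. Qed.

Lemma crossed_cstar : cstar_subalgebra (crossed R G).
Proof.
split=> [T|||T S|T].
- by move=> /(_ bounded_ops); apply; split; [exact: bounded_cstar|];
    move=> _ [[f fb <-]|[g _ <-]]; [exact: mulop_bounded|exact: lreg_bounded].
- split=> [|c T S TA SA] A HA; have [[_ [A0 Alin] _ _ _] _] := HA; first exact: A0.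
  by apply: Alin; [exact: TA|exact: SA].
- by move=> T S TA SA A HA; have [[_ _ AM _ _] _] := HA; apply: AM; [exact: TA|exact: SA].
- move=> TA Sb TS A HA; have [[_ _ _ AJ _] _] := HA.
  by apply: (AJ T) => //; exact: TA.
move=> Tb HT A HA; have [[_ _ _ _ Acl] _] := HA; apply: Acl => // e e0.
by have [S SA TS] := HT e e0; exists S => //; exact: SA.
Qed.

Lemma crossed_bounded T : crossed R G T -> bounded_ops T.
Proof. by have [cb _ _ _ _] := crossed_cstar => /cb. Qed.

Lemma crossed0 : crossed R G 0.
Proof. by have [_ [c0 _] _ _ _] := crossed_cstar. Qed.

Lemma crossed_lin c T S : crossed R G T -> crossed R G S -> crossed R G (c *: T + S).
Proof. by have [_ [_ cl] _ _ _] := crossed_cstar; apply: cl. Qed.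

Lemma crossed_comp T S : crossed R G T -> crossed R G S -> crossed R G (T \o S).
Proof. by have [_ _ cM _ _] := crossed_cstar; apply: cM. Qed.

Lemma crossedD T S : crossed R G T -> crossed R G S -> crossed R G (T + S).
Proof. by move=> cT cS; rewrite -[T]scale1r; exact: crossed_lin. Qed.

Lemma crossedB T S : crossed R G T -> crossed R G S -> crossed R G (T - S).
Proof. by move=> cT cS; rewrite addrC -scaleN1r; exact: crossed_lin. Qed.

Lemma crossed_closed T : bounded_ops T -> op_approx (crossed R G) T -> crossed R G T.
Proof. by have [_ _ _ _ cc] := crossed_cstar; apply: cc. Qed.

Lemma crossed_mulop f : linfty f -> crossed R G (mulop f).
Proof. by move=> fb A [_]; apply; left; exists f. Qed.

Lemma crossed_lreg g : crossed R G (lreg g).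
Proof. by move=> A [_]; apply; right; exists g. Qed.

Lemma crossed_mono f g : linfty f -> crossed R G (mulop f \o lreg g).
Proof. by move=> fb; apply: crossed_comp; [exact: crossed_mulop|exact: crossed_lreg]. Qed.

(** Finite sums of operators [M_f U_g], presented one term at a time so that their
stability properties follow by induction on the number of terms. *)
Inductive fourier : (H -> H) -> Prop :=
| fourier0 : fourier 0
| fourier_cons f g T : linfty f -> fourier T -> fourier (mulop f \o lreg g + T).

Lemma fourier_crossed T : fourier T -> crossed R G T.
Proof.
by elim=> [|f g S fb _ IH]; [exact: crossed0|apply: crossedD => //; exact: crossed_mono].
Qed.

Lemma fourier_bounded T : fourier T -> bounded_ops T.
Proof. by move=> /fourier_crossed; exact: crossed_bounded. Qed.

Lemma fourier_mono f g : linfty f -> fourier (mulop f \o lreg g).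
Proof. by move=> fb; rewrite -[_ \o _]addr0; apply: fourier_cons => //; exact: fourier0. Qed.

Lemma fourierD T S : fourier T -> fourier S -> fourier (T + S).
Proof.
move=> FT FS; elim: FT => [|f g T' fb _ IH]; first by rewrite add0r.
by rewrite -addrA; exact: fourier_cons.
Qed.

Lemma mono_apply f g x h : linfty f -> (mulop f \o lreg g) x h = f h * x (g^-1 * h)%g.
Proof. by move=> fb; rewrite /= mulopE// lregE. Qed.

Lemma fourierZ c T : fourier T -> fourier (c *: T).
Proof.
elim=> [|f g T' fb _ IH]; first by rewrite scaler0; exact: fourier0.
rewrite scalerDr; have -> : c *: (mulop f \o lreg g) =
  mulop (fun i => c * f (id i) : C^o) \o lreg g.
  have b3 := linftyM id (linfty_cst G c) fb.
  by apply/funext => x; apply: l2P => h;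
    rewrite opZE l2Z (mono_apply _ _ _ fb) (mono_apply _ _ _ b3) mulrA.
by apply: fourier_cons => //; apply: (@linftyM _ _ (fun _ => c)) => //; exact: linfty_cst.
Qed.

(** The covariance relation: moving U_(g1) past M_(f2) translates f2. *)
Lemma mono_comp f1 g1 f2 g2 : linfty f1 -> linfty f2 ->
  (mulop f1 \o lreg g1) \o (mulop f2 \o lreg g2) =
  mulop (fun h => f1 h * f2 (g1^-1 * h)%g : C^o) \o lreg (g1 * g2)%g.
Proof.
move=> f1b f2b; have b3 := linftyM (fun h => g1^-1 * h)%g f1b f2b.
apply/funext => x; apply: l2P => h /=.
rewrite (mulopE _ _ f1b) lregE (mulopE _ _ f2b) lregE (mulopE _ _ b3) lregE.
by rewrite mulrA invgM mulgA.
Qed.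

Lemma fourier_comp T S : fourier T -> fourier S -> fourier (T \o S).
Proof.
move=> FT FS; elim: FT => [|f g T' fb _ IH]; first exact: fourier0.
have -> : (mulop f \o lreg g + T') \o S = ((mulop f \o lreg g) \o S) + (T' \o S) by [].
apply: fourierD => //; elim: FS => [|f' g' S' fb' _ IH'].
  suff -> : (mulop f \o lreg g) \o (0 : H -> H) = 0 by exact: fourier0.
  apply/funext => x; have bb := bounded_ops_comp (mulop_bounded fb) (lreg_bounded g).
  exact: (bop0 bb).
have -> : (mulop f \o lreg g) \o (mulop f' \o lreg g' + S') =
   ((mulop f \o lreg g) \o (mulop f' \o lreg g')) + ((mulop f \o lreg g) \o S').
  apply/funext => x; have bb := bounded_ops_comp (mulop_bounded fb) (lreg_bounded g).
  exact: (bopD bb).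
by apply: fourierD => //; rewrite mono_comp//; apply: fourier_mono; exact: linftyM.
Qed.

Lemma mono_bounded f g : linfty f -> bounded_ops (mulop f \o lreg g).
Proof. by move=> fb; apply: bounded_ops_comp; [exact: mulop_bounded|exact: lreg_bounded]. Qed.

Lemma mono_adjoint f g : linfty f ->
  is_adjoint (mulop f \o lreg g) (mulop (fun h => (f (g * h)%g)^* : C^o) \o lreg g^-1%g).
Proof.
move=> fb; have fb' := linftyJ (fun h => g * h)%g fb.
apply/is_adjointP; [exact: mono_bounded|exact: mono_bounded|move=> i j].
rewrite (mono_apply _ _ _ fb') (mono_apply _ _ _ fb) !l2deltaE invgK rmorphM/= rmorph_nat.
have [<-|ij] := eqVneq (g * j)%g i; first by rewrite mulKg eqxx.
rewrite mulr0; case: eqP => [ij'|]; last by rewrite mulr0.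
by case/eqP: ij; rewrite -ij' mulVKg.
Qed.

Lemma fourier_adjoint T : fourier T -> exists2 S, fourier S & is_adjoint T S.
Proof.
elim=> [|f g T' fb _ [S FS TS]].
  exists 0; first exact: fourier0.
  by apply/is_adjointP; [exact: bounded_ops0|exact: bounded_ops0|move=> i j; apply/esym;
    exact: conjC0].
exists (mulop (fun h => (f (g * h)%g)^* : C^o) \o lreg g^-1%g + S).
  by apply: fourier_cons => //; exact: linftyJ.
by apply: is_adjointD => //; exact: mono_adjoint.
Qed.

Definition fourier_limits : set (H -> H) := [set T | bounded_ops T /\ op_approx fourier T].

(** Stability under products uses T S - T' S' = T (S - S') + (T - T') S', where the
norm of S' stays bounded; stability under adjoints uses that passing to the
adjoint preserves operator norms. *)
Lemma fourier_limits_cstar : cstar_subalgebra fourier_limits.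
Proof.
split.
- by move=> T [].
- split.
    split; first exact: bounded_ops0.
    move=> e e0; exists 0; first exact: fourier0.
    by move=> x; rewrite subrr -[(0 : H -> H) x]/(0 : H) normr0 mulr_ge0// ltW.
  move=> c T S [bT aT] [bS aS]; split; first exact: bounded_ops_lin.
  apply: (@op_approxK _ _ _ _ (`|c| + 1)) => [|e e0 _]; first exact: addr_ge0.
  have [T' FT' TT'] := aT e e0; have [S' FS' SS'] := aS e e0.
  exists (c *: T' + S'); first by apply: fourierD => //; exact: fourierZ.
  rewrite opprD addrACA -scalerBr mulrDl mul1r; apply: opnorm_leD => //.
  exact: opnorm_leZ.
- move=> T S [bT aT] [bS aS]; split; first exact: bounded_ops_comp.
  have /bounded_opsP[_ [c c0 Tc]] := bT; have /bounded_opsP[_ [d d0 Sd]] := bS.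
  apply: (@op_approxK _ _ _ _ (c + (d + 1))) => [|e e0 e1]; first by rewrite !addr_ge0.
  have [T' FT' TT'] := aT e e0; have [S' FS' SS'] := aS e e0.
  exists (T' \o S'); first exact: fourier_comp.
  have -> : T \o S - (T' \o S') = (T \o (S - S')) + ((T - T') \o S').
    apply/funext => x; rewrite opBE opDE /= !opBE (bopB bT).
    by rewrite addrA subrK.
  have S'd : opnorm_le S' (d + 1).
    have -> : S' = S - (S - S') by rewrite opprB addrC subrK.
    by apply: opnorm_leD => //; apply: opnorm_leN; exact: opnorm_le_weak SS'.
  rewrite mulrDl; apply: opnorm_leD; first exact: opnorm_le_comp.
  by rewrite mulrC; apply: opnorm_le_comp => //; exact: ltW.
- move=> T S [bT aT] bS TS; split; first exact: bS.
  move=> e e0.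
  have [T' FT' TT'] := aT e e0; have [S' FS' TS'] := fourier_adjoint FT'.
  exists S' => //; apply: adjoint_opnorm TT'; first exact: ltW.
  exact: is_adjointB.
- move=> T bT aT; split=> //.
  apply: (@op_approxK _ _ _ _ 2) => // e e0 _.
  have [S [_ aS] TS] := aT e e0; have [S' FS' SS'] := aS e e0; exists S' => //.
  have -> : T - S' = (T - S) + (S - S') by rewrite addrA subrK.
  by rewrite mulr_natl mulr2n; exact: opnorm_leD.
Qed.

(** The norm limits of finite Fourier sums form a C*-algebra that contains the
generators, so they contain the smallest such algebra. *)
Lemma fourier_dense T : crossed R G T -> op_approx fourier T.
Proof.
suff : crossed R G `<=` fourier_limits by move=> /[apply] -[].
apply: smallest_sub; first exact: fourier_limits_cstar.
have sub T' : fourier T' -> fourier_limits T'.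
  move=> FT; split; first exact: fourier_bounded.
  move=> e e0; exists T' => // x.
  by rewrite subrr -[(0 : H -> H) x]/(0 : H) normr0 mulr_ge0// ltW.
move=> _ [[f fb <-]|[g _ <-]]; apply: sub.
  have -> : mulop f = mulop f \o lreg 1%g.
    by apply/funext => x; apply: l2P => h /=;
      rewrite (mulopE _ _ fb) (mulopE _ _ fb) lregE invg1 mul1g.
  exact: fourier_mono.
have b1 := @linfty_cst R G 1.
have -> : lreg g = mulop (fun=> 1 : C^o) \o lreg g.
  by apply/funext => x; apply: l2P => h /=; apply/esym; rewrite (mulopE _ _ b1); exact: mul1r.
exact: fourier_mono.
Qed.

End CrossedProduct.

(** * Compact sets of complex numbers *)

Section ComplexDisc.
Variable R : realType.
Local Notation C := R[i].

Lemma complex_pair_continuous : continuous (fun xy : R * R => (xy.1 +i* xy.2 : C^o)).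
Proof.
move=> [x y]; apply/cvgrPdist_le => e e0.
have [d d0 ed] := ge0_real_complex (ltW e0).
have {}d0 : 0 < d / 2 by rewrite divr_gt0//; move: e0; rewrite ed ltcR.
near=> uv => /=.
have -> : x +i* y - uv.1 +i* uv.2 = (x - uv.1)%:C + 'i%C * (y - uv.2)%:C.
  by rewrite [RHS](_ : _ = (x - uv.1) +i* (y - uv.2)) // [RHS]complexE.
have nR (a : R) : `|a%:C| = `|a|%:C :> C by rewrite normc_def /= expr0n addr0 sqrtr_sqr.
have ni : `|'i%C| = 1 :> C by rewrite normc_def /= expr0n expr1n add0r sqrtr1.
apply: le_trans (ler_normD _ _) _; rewrite normrM ni mul1r !nR ed.
rewrite -(rmorphD (real_complex R)) lecR [leRHS]splitr lerD//; near: uv.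
  apply: (@cvgr_dist_le _ _ _ _ _ (fun uv : R * R => uv.1) x) => //; exact: cvg_fst.
apply: (@cvgr_dist_le _ _ _ _ _ (fun uv : R * R => uv.2) y) => //; exact: cvg_snd.
Unshelve. all: by end_near. Qed.

Definition rectangle (M : R) : set C^o :=
  (fun xy : R * R => xy.1 +i* xy.2) @` (`[- M, M]%classic `*` `[- M, M]%classic).

Lemma rectangle_compact M : compact (rectangle M).
Proof.
apply: continuous_compact.
  by apply: continuous_subspaceT; exact: complex_pair_continuous.
by apply: compact_setX; exact: segment_compact.
Qed.

Lemma normc_rectangle M (z : C^o) : `|z| <= M%:C -> rectangle M z.
Proof.
move=> zM; exists (complex.Re z, complex.Im z); last by case: (z).
have zi : `|complex.Im z|%:C <= `|z|.
  have := normc_ge_Re (z * 'i%C); rewrite ReiNIm normrN normrM => /le_trans; apply.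
  by rewrite [X in _ * X]normc_def /= expr0n expr1n add0r sqrtr1 mulr1.
split => /=; rewrite in_itv/= -ler_norml -lecR; first exact: le_trans (normc_ge_Re z) zM.
exact: le_trans zi zM.
Qed.

Lemma disc_closed (V : normedModType C) c : closed [set z : V | `|z| <= c].
Proof.
move=> z zc /=; apply/ler_addgt0Pr => e e0.
have /zc[y [/= yc]] : nbhs z (fun y => `|z - y| <= e).
  by apply: (@cvgr_dist_le _ _ _ _ _ id z) => //; exact: cvg_id.
move=> zy; rewrite -[z](subrK y) addrC [leRHS]addrC.
by apply: le_trans (ler_normD _ _) _; rewrite addrC lerD.
Qed.

Lemma disc_compact c : compact [set z : C^o | `|z| <= c].
Proof.
have [c0|] := pselect (0 <= c); last first.
  move=> nc0; rewrite (_ : [set _ | _] = set0); first exact: compact0.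
  by rewrite -subset0 => z /= zc; apply: nc0; exact: le_trans zc.
have [M M0 ->] := ge0_real_complex c0.
apply: (subclosed_compact _ (@rectangle_compact M)); first exact: disc_closed.
by move=> z; exact: normc_rectangle.
Qed.

(** The universal property of the Stone-Cech compactification concerns compact
target spaces, so a compact set of complex numbers has to be turned into a
compact space. *)
Lemma set_type_compact (X : topologicalType) (A : set X) : compact A -> compact [set: A].
Proof.
move=> cA F PF _.
have [p [Ap Fp]] := cA (set_val @ F) _ (filterS (fun a _ => set_valP a) filterT).
exists (exist _ p (mem_set Ap)); split => // U V FU /= [B [[W oW <-] /= Wp BV]].
have [] := Fp (set_val @` U) W; last 1 first.
- move=> q [[a Ua <-] Wa]; exists a; split => //; exact: BV.
- by rewrite nbhs_simpl /=; apply: filterS FU => a Ua /=; exists a.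
by move: Wp; rewrite set_valE /= => Wp; exact: open_nbhs_nbhs.
Qed.

Lemma set_type_hausdorff (X : topologicalType) (A : set X) :
  hausdorff_space X -> hausdorff_space A.
Proof.
move=> hX p q pq; apply: val_inj; apply: hX => U V pU qV.
have [r [Ur Vr]] := pq (set_val @^-1` U) (set_val @^-1` V)
  (@initial_continuous _ _ (@set_val _ A) p U pU) (@initial_continuous _ _ (@set_val _ A) q V qV).
by exists (set_val r).
Qed.

End ComplexDisc.

(** * Extension of functions to the Stone-Cech compactification *)

Section StoneCechExtension.
Variables (G : Type) (bG : topologicalType) (iota : G -> bG).
Hypothesis sc : stone_cech iota.

(** If the two values differed, separating them would give a nonempty open subset
of V that misses the dense set of group elements. *)
Lemma sc_eq_local (K : topologicalType) (F1 F2 : bG -> K) (V : set bG) w :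
  hausdorff_space K -> continuous F1 -> continuous F2 -> open V -> V w ->
  (forall j, V (iota j) -> F1 (iota j) = F2 (iota j)) -> F1 w = F2 w.
Proof.
move=> hK c1 c2 oV Vw F12; apply: contrapT => /eqP ne.
move: hK; rewrite open_hausdorff => /(_ _ _ ne)[[A B] /= [wA wB] [oA oB AB]].
have [_ _ dense_iota _] := sc.
have [||x [[[Ax Bx] Vx] [j _ jx]]] := dense_iota (F1 @^-1` A `&` F2 @^-1` B `&` V).
- by exists w; split => //; split; apply: set_mem.
- apply: openI => //; apply: openI; apply: open_comp => //.
suff : (A `&` B) (F1 x) by move/eqP: AB => ->.
by split=> //; rewrite -jx F12 ?jx.
Qed.

Lemma sc_eq (K : topologicalType) (F1 F2 : bG -> K) :
  hausdorff_space K -> continuous F1 -> continuous F2 ->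
  F1 \o iota = F2 \o iota -> F1 = F2.
Proof.
move=> hK c1 c2 F12; apply/funext => w.
apply: (@sc_eq_local K F1 F2 setT) => //; first exact: openT.
by move=> j _; exact: (congr1 (@^~ j) F12).
Qed.

Lemma sc_adherent (K : numFieldType) (V : normedModType K) (F : bG -> V) (e : K) w :
  continuous F -> 0 < e -> exists j, `|F w - F (iota j)| <= e.
Proof.
move=> cF e0; have [_ _ dense_iota _] := sc.
have [U [oU Uw UF]] : exists U, [/\ open U, U w & forall x, U x -> `|F w - F x| <= e].
  have /cvgrPdist_le/(_ e e0) := cF w.
  by rewrite near_simpl /= => /nbhs_interior; rewrite nbhsE => -[U [oU Uw] UF]; exists U;
    split => // x /UF/nbhs_singleton.
have [||x [Ux [j _ jx]]] := dense_iota U => //; first by exists w.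
by exists j; rewrite jx; exact: UF.
Qed.

End StoneCechExtension.

Section Extension.
Variables (R : realType) (G : groupType) (bG : topologicalType) (iota : G -> bG).
Local Notation C := R[i].
Hypothesis sc : stone_cech iota.
Implicit Types (f : G -> C^o) (g h j : G) (w : bG).

Lemma ext_ex (K : topologicalType) (f : G -> K) :
  (exists2 F : bG -> K, continuous F & F \o iota = f) ->
  continuous (ext iota f) /\ ext iota f \o iota = f.
Proof. by move=> [F cF Ff]; rewrite /ext;
  apply: (@xgetPex _ _ [set F | continuous F /\ F \o iota = f]); exists F. Qed.

Lemma ext_linftyP f : linfty f -> continuous (ext iota f) /\ ext iota f \o iota = f.
Proof.
move=> /linfty_bound[c /ge0_real_complex[M M0 ->] fM]; apply: ext_ex.
have [_ _ _ univ] := sc.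
pose K := (rectangle M).
pose f' (g : G) : K := exist _ (f g) (mem_set (normc_rectangle (fM g))).
have [||F cF Ff] := univ K f'.
- exact/set_type_compact/rectangle_compact.
- by apply: set_type_hausdorff; exact: norm_hausdorff.
exists (set_val \o F); last first.
  by apply/funext => g; rewrite /= -[F (iota g)]/((F \o iota) g) Ff.
move=> w; apply: continuous_comp; first exact: cF.
exact: initial_continuous.
Qed.

Lemma ext_continuous f : linfty f -> continuous (ext iota f).
Proof. by move=> /ext_linftyP[]. Qed.

Lemma ext_iota f g : linfty f -> ext iota f (iota g) = f g.
Proof. by move=> /ext_linftyP[_ fE]; rewrite -[in RHS]fE. Qed.

Lemma ext_unique f (F : bG -> C^o) : linfty f -> continuous F ->
  (forall g, F (iota g) = f g) -> ext iota f = F.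
Proof.
move=> fb cF Ff; apply: (sc_eq sc); [exact: norm_hausdorff|exact: ext_continuous|exact: cF|].
by apply/funext => g /=; rewrite ext_iota.
Qed.

Lemma ext_local f1 f2 (V : set bG) w : linfty f1 -> linfty f2 -> open V -> V w ->
  (forall j, V (iota j) -> f1 j = f2 j) -> ext iota f1 w = ext iota f2 w.
Proof.
move=> b1 b2 oV Vw f12; apply: (sc_eq_local sc _ _ _ oV Vw).
- exact: norm_hausdorff.
- exact: ext_continuous.
- exact: ext_continuous.
by move=> j Vj; rewrite !ext_iota// f12.
Qed.

Lemma linftyD f1 f2 : linfty f1 -> linfty f2 -> linfty (fun i => f1 i + f2 i : C^o).
Proof.
move=> [M fM] [N fN]; exists (M + N) => i; apply: le_trans (ler_normD _ _) _.
exact: lerD.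
Qed.

Lemma ext_cst (a : C) : ext iota (fun=> a : C^o) = fun=> a.
Proof. by apply: ext_unique => //; [exact: linfty_cst|move=> w; exact: cvg_cst]. Qed.

Lemma ext_add f1 f2 w : linfty f1 -> linfty f2 ->
  ext iota (fun g => f1 g + f2 g : C^o) w = ext iota f1 w + ext iota f2 w.
Proof.
move=> b1 b2; rewrite (@ext_unique _ (fun w => ext iota f1 w + ext iota f2 w : C^o))//.
- exact: linftyD.
- by move=> v; apply: cvgD; exact: ext_continuous.
- by move=> g; rewrite !ext_iota.
Qed.

Lemma ext_mul f1 f2 w : linfty f1 -> linfty f2 ->
  ext iota (fun g => f1 g * f2 g : C^o) w = ext iota f1 w * ext iota f2 w.
Proof.
move=> b1 b2; rewrite (@ext_unique _ (fun w => ext iota f1 w * ext iota f2 w : C^o))//.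
- exact: (linftyM id).
- by move=> v; apply: cvgM; exact: ext_continuous.
- by move=> g; rewrite !ext_iota.
Qed.

Lemma ext_conj f w : linfty f -> ext iota (fun g => (f g)^* : C^o) w = (ext iota f w)^*.
Proof.
move=> b1; rewrite (@ext_unique _ (fun w => (ext iota f w)^* : C^o))//.
- exact: (linftyJ id).
- move=> v; apply/cvgrPdist_le => e e0.
  have cf : ext iota f x @[x --> v] --> ext iota f v by exact: ext_continuous.
  move/cvgrPdist_le/(_ e e0) : cf.
  by rewrite !near_simpl; apply: filterS => x; rewrite -rmorphB norm_conjC.
- by move=> g; rewrite !ext_iota.
Qed.

(** The left side is a continuous function of w bounded by c on the dense set of
group elements. *)
Lemma ext_sum_le (I : choiceType) (X : {fset I}) (f : I -> G -> C^o) (c : C) w :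
  (forall i, linfty (f i)) -> (forall j, \sum_(i <- X) `|f i j| ^+ 2 <= c) ->
  \sum_(i <- X) `|ext iota (f i) w| ^+ 2 <= c.
Proof.
move=> fb fc; pose F (v : bG) : C^o := \sum_(i <- X) `|ext iota (f i) v| ^+ 2.
have cF : continuous F.
  move=> v; rewrite /F; elim: (X : seq I) => [|i s IH].
    rewrite (_ : (fun v0 => _) = cst (0 : C^o)); first exact: cst_continuous.
    by apply/funext => x; rewrite big_nil.
  have cn : `|ext iota (f i) x| @[x --> v] --> (`|ext iota (f i) v| : C^o).
    by apply: cvg_norm; exact: ext_continuous.
  rewrite (_ : (fun v0 => _) = fun v0 => `|ext iota (f i) v0| * `|ext iota (f i) v0| +
    \sum_(i <- s) `|ext iota (f i) v0| ^+ 2 : C^o); last first.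
    by apply/funext => x; rewrite big_cons expr2.
  by rewrite /continuous_at; apply: cvgD IH; exact: cvgM.
rewrite -/(F w); apply/ler_addgt0Pr => e e0.
have [j wj] := sc_adherent sc w cF e0.
have Fj : F (iota j) <= c.
  by rewrite /F; under eq_bigr do rewrite ext_iota//.
have F0 v : 0 <= F v by apply: sumr_ge0 => i _; exact: exprn_ge0.
rewrite -[F w](subrK (F (iota j))) addrC lerD//; apply: le_trans wj.
by rewrite real_ler_norm// realB ?ger0_real.
Qed.

Lemma ext_norm_le f (c : C) w : linfty f -> 0 <= c -> (forall j, `|f j| <= c) ->
  `|ext iota f w| <= c.
Proof.
move=> fb c0 fc; have := @ext_sum_le _ [fset tt]%fset (fun=> f) (c ^+ 2) w.
rewrite big_seq_fset1 ler_sqr ?nnegrE//; apply=> // j.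
by rewrite big_seq_fset1 ler_sqr ?nnegrE.
Qed.

Lemma linfty_ext f (k : G -> bG) : linfty f -> linfty (fun g => ext iota f (k g)).
Proof.
move=> fb; have [c c0 fc] := linfty_bound fb; exists c => g; exact: ext_norm_le.
Qed.

Lemma act_continuous g : continuous (act iota g).
Proof. by have [cb hb _ univ] := sc; have [|//] := @ext_ex bG (fun h => iota (g * h)%g);
  exact: univ. Qed.

Lemma act_iota g h : act iota g (iota h) = iota (g * h)%g.
Proof.
have [cb hb _ univ] := sc; have [|_ /(congr1 (@^~ h))//] := @ext_ex bG (fun h => iota (g * h)%g).
exact: univ.
Qed.

Lemma act_mul g h w : act iota g (act iota h w) = act iota (g * h)%g w.
Proof.
have [_ hb _ _] := sc.
apply: (congr1 (@^~ w) (_ : act iota g \o act iota h = act iota (g * h)%g)).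
apply: (sc_eq sc) => //.
- by move=> v; apply: continuous_comp; exact: act_continuous.
- exact: act_continuous.
by apply/funext => j /=; rewrite !act_iota mulgA.
Qed.

Lemma act1 w : act iota 1%g w = w.
Proof.
have [_ hb _ _] := sc.
apply: (congr1 (@^~ w) (_ : act iota 1%g = id)).
apply: (sc_eq sc) => //.
- exact: act_continuous.
- by move=> v; exact: cvg_id.
by apply/funext => j /=; rewrite !act_iota mul1g.
Qed.

Lemma ext_act f g w : linfty f -> ext iota f (act iota g w) = ext iota (fun j => f (g * j)%g) w.
Proof.
move=> fb; have fb' : linfty (fun j => f (g * j)%g) := linfty_comp (fun j => g * j)%g fb.
rewrite (@ext_unique (fun j => f (g * j)%g) (ext iota f \o act iota g))//.
  by move=> v; apply: continuous_comp; [exact: act_continuous|exact: ext_continuous].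
by move=> j /=; rewrite act_iota ext_iota.
Qed.

Lemma rtrans_continuous w : continuous (rtrans iota w).
Proof. by have [cb hb _ univ] := sc; have [|//] := @ext_ex bG (fun g => act iota g w);
  exact: univ. Qed.

Lemma rtrans_iota w g : rtrans iota w (iota g) = act iota g w.
Proof.
have [cb hb _ univ] := sc; have [|_ /(congr1 (@^~ g))//] := @ext_ex bG (fun g => act iota g w).
exact: univ.
Qed.

Lemma ext_rtrans f w v : linfty f -> ext iota f (rtrans iota w v) = ext iota (pull iota w f) v.
Proof.
move=> fb; have fb' : linfty (pull iota w f) by exact: linfty_ext.
rewrite (@ext_unique (pull iota w f) (ext iota f \o rtrans iota w))//.
  by move=> u; apply: continuous_comp; [exact: rtrans_continuous|exact: ext_continuous].
by move=> j /=; rewrite rtrans_iota.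
Qed.

End Extension.

(** * The representation as a weak limit of right translates *)

Section WeakLimit.
Variables (R : realType) (G : groupType) (bG : topologicalType) (iota : G -> bG).
Variable omega : bG.
Local Notation C := R[i].
Local Notation H := (l2 R G).
Hypothesis sc : stone_cech iota.
Implicit Types (T S : H -> H) (x y : H) (f : G -> C^o) (g h j k : G) (c e : C).

Definition rreg j : H -> H := @l2_comp R G (fun h => h * j^-1)%g.

Lemma rregE j x h : rreg j x h = x (h * j^-1)%g.
Proof. by rewrite l2_compE//; exact: mulIg. Qed.

Lemma rreg_opnorm j : opnorm_le (rreg j) 1.
Proof. by apply: l2_comp_opnorm; exact: mulIg. Qed.

Lemma rreg_bounded j : bounded_ops (rreg j).
Proof. by apply: l2_comp_bounded; exact: mulIg. Qed.

Lemma rreg_delta j h : rreg j (l2delta R h) = l2delta R (h * j)%g.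
Proof.
apply: l2P => k; rewrite rregE !l2deltaE; congr (_%:R); congr nat_of_bool.
by apply/eqP/eqP => [<-|->]; rewrite (mulgVK, mulgK).
Qed.

(** The weak limit, as j tends to omega, of the conjugates of T by the right
translations [rreg j]. *)
Definition wlim T : H -> H :=
  fun x => to_l2 (fun k => ext iota (fun j => T (rreg j x) (k * j)%g) omega).

(** The family (T (rreg j x) (k j))_k is a right translate of T (rreg j x), which has
norm at most c |x|. *)
Lemma translate_fsum_le T c x (X : {fset G}) j : 0 <= c -> opnorm_le T c ->
  \sum_(k <- X) `|T (rreg j x) (k * j)%g| ^+ 2 <= (c * `|x|) ^+ 2.
Proof.
move=> c0 Tc; apply: le_trans (@fsum_comp_le _ _ (fun k => k * j)%g _ _ _) _.
  exact: mulIg.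
rewrite ler_sqr ?nnegrE ?mulr_ge0//; apply: le_trans (Tc _) _.
by rewrite ler_wpM2l//; have := rreg_opnorm j x; rewrite mul1r.
Qed.

Lemma translates_linfty T x k : bounded_ops T -> linfty (fun j => T (rreg j x) (k * j)%g : C^o).
Proof.
move=> /bounded_opsP[_ [c c0 Tc]]; exists (c * `|x|) => j.
have := translate_fsum_le x [fset k]%fset j c0 Tc.
by rewrite big_seq_fset1 ler_sqr ?nnegrE ?mulr_ge0.
Qed.

Lemma coef_linfty T h k : bounded_ops T ->
  linfty (fun j => T (l2delta R (h * j)%g) (k * j)%g : C^o).
Proof.
move=> bT; rewrite (_ : (fun j => _) = (fun j => T (rreg j (l2delta R h)) (k * j)%g : C^o)).
  exact: translates_linfty.
by apply/funext => j; rewrite rreg_delta.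
Qed.

Lemma wlim_fsum_le T c x (X : {fset G}) : 0 <= c -> bounded_ops T -> opnorm_le T c ->
  \sum_(k <- X) `|ext iota (fun j => T (rreg j x) (k * j)%g : C^o) omega| ^+ 2 <= (c * `|x|) ^+ 2.
Proof.
move=> c0 bT Tc; apply: (ext_sum_le sc (f := fun k j => T (rreg j x) (k * j)%g)) => [k|j].
  exact: translates_linfty.
exact: translate_fsum_le.
Qed.

Lemma wlimE T x k : bounded_ops T ->
  wlim T x k = ext iota (fun j => T (rreg j x) (k * j)%g) omega.
Proof.
move=> bT; rewrite /wlim to_l2E//; have /bounded_opsP[_ [c c0 Tc]] := bT.
by apply: (@l2_predI _ _ _ (c * `|x|)) => [|X]; [exact: mulr_ge0|exact: wlim_fsum_le].
Qed.

Lemma wlim_opnorm T c : 0 <= c -> bounded_ops T -> opnorm_le T c -> opnorm_le (wlim T) c.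
Proof.
move=> c0 bT Tc x; apply: l2_norm_le => [|X]; first exact: mulr_ge0.
by under eq_bigr do rewrite wlimE//; exact: wlim_fsum_le.
Qed.

Lemma wlim_bounded T : bounded_ops T -> bounded_ops (wlim T).
Proof.
move=> bT; have /bounded_opsP[Tl [c c0 Tc]] := bT; apply/bounded_opsP; split; last first.
  by exists c => //; exact: wlim_opnorm.
move=> a x y; apply: l2P => k;
  rewrite (wlimE (a *: x + y) k bT) (l2D (a *: wlim T x)) (l2Z a (wlim T x)).
rewrite [X in _ = _ * X + _](wlimE x k bT) [X in _ = _ + X](wlimE y k bT).
have b1 := translates_linfty x k bT; have b2 := translates_linfty y k bT.
rewrite (_ : (fun j => T (rreg j (a *: x + y)) (k * j)%g) =
    (fun j => (a : C^o) * T (rreg j x) (k * j)%g + T (rreg j y) (k * j)%g)); last first.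
  by apply/funext => j; rewrite (bopP (rreg_bounded j)) Tl.
have ba := linfty_cst G a.
rewrite (ext_add sc _ _ b2); last exact: (linftyM id ba b1).
by rewrite (ext_mul sc _ ba b1) (ext_cst sc).
Qed.

(** Matrix entries: right translation by j sends the entry (k, h) to (k j, h j). *)
Lemma wlim_coef T h k : bounded_ops T ->
  wlim T (l2delta R h) k = ext iota (fun j => T (l2delta R (h * j)%g) (k * j)%g) omega.
Proof.
move=> bT; rewrite wlimE//; congr ext; apply/funext => j.
by rewrite rreg_delta.
Qed.

Lemma wlim_lin c T S : bounded_ops T -> bounded_ops S ->
  wlim (c *: T + S) = c *: wlim T + wlim S.
Proof.
move=> bT bS; have bTS := bounded_ops_lin c bT bS.
apply/funext => x; apply: l2P => k;
  rewrite opDE opZE (l2D (c *: wlim T x)) (l2Z c (wlim T x)) (wlimE _ _ bTS) (wlimE _ _ bT)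
    (wlimE _ _ bS).
have b1 := translates_linfty x k bT; have b2 := translates_linfty x k bS.
have ba := linfty_cst G c.
transitivity (ext iota (fun j => (c : C^o) * T (rreg j x) (k * j)%g +
  S (rreg j x) (k * j)%g : C^o) omega).
  by congr ext.
rewrite (ext_add sc _ _ b2); last exact: (linftyM id ba b1).
by rewrite (ext_mul sc _ ba b1) (ext_cst sc).
Qed.

Lemma wlim0 : wlim 0 = 0.
Proof.
have := wlim_lin (-1) (@bounded_ops0 R H) (@bounded_ops0 R H).
by rewrite scaler0 addr0 scaleN1r addNr.
Qed.

Lemma wlimD T S : bounded_ops T -> bounded_ops S -> wlim (T + S) = wlim T + wlim S.
Proof. by move=> bT bS; rewrite -[T]scale1r wlim_lin// !scale1r. Qed.

Lemma wlimB T S : bounded_ops T -> bounded_ops S -> wlim (T - S) = wlim T - wlim S.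
Proof. by move=> bT bS; rewrite addrC -scaleN1r wlim_lin// scaleN1r addrC. Qed.

Lemma wlim_adjoint T S : bounded_ops T -> bounded_ops S -> is_adjoint T S ->
  is_adjoint (wlim T) (wlim S).
Proof.
move=> bT bS /(is_adjointP bT bS) TS.
apply/is_adjointP; [exact: wlim_bounded|exact: wlim_bounded|move=> i j].
rewrite (wlim_coef _ _ bT) (wlim_coef _ _ bS) -(ext_conj sc); last exact: coef_linfty.
by congr ext; apply/funext => l; rewrite TS.
Qed.

Lemma pull_linfty f : linfty f -> linfty (pull iota omega f).
Proof. by move=> fb; exact: linfty_ext. Qed.

Lemma pullE f k : linfty f -> pull iota omega f k = ext iota (fun j => f (k * j)%g) omega.
Proof. by move=> fb; rewrite /pull ext_act. Qed.

Lemma mono_delta f g h : linfty f ->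
  (mulop f \o lreg g) (l2delta R h) = f (g * h)%g *: l2delta R (g * h)%g.
Proof.
move=> fb; apply: l2P => k; rewrite l2Z /= (mulopE _ _ fb) lreg_delta l2deltaE.
by case: eqP => [->//|_]; rewrite !mulr0.
Qed.

(** On basis vectors [M_f U_g] acts by a scalar followed by a translation, and
evaluation at omega is multiplicative on bounded functions. *)
Lemma wlim_comp_mono T f g : bounded_ops T -> linfty f ->
  wlim (T \o (mulop f \o lreg g)) = wlim T \o (mulop (pull iota omega f) \o lreg g).
Proof.
move=> bT fb; have bm := mono_bounded g fb; have pb := pull_linfty fb.
apply: bounded_ops_ext.
- exact/wlim_bounded/bounded_ops_comp.
- by apply: bounded_ops_comp; [exact: wlim_bounded|exact: mono_bounded].
move=> h k; rewrite (wlim_coef h k (bounded_ops_comp bT bm)).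
rewrite [RHS]/= -[mulop _ (lreg _ _)]/((mulop (pull iota omega f) \o lreg g) (l2delta R h)).
rewrite (mono_delta _ _ pb).
rewrite (bopZ (wlim_bounded bT)) (l2Z _ (wlim T _)).
rewrite (wlim_coef _ _ bT).
rewrite (pullE _ fb).
rewrite -(ext_mul sc); [|exact: (linfty_comp (fun j => g * h * j)%g fb)|exact: coef_linfty].
congr ext; apply/funext => j.
rewrite -[(T \o _) _]/(T ((mulop f \o lreg g) (l2delta R (h * j)%g))) (mono_delta _ _ fb).
by rewrite (bopZ bT) l2Z mulgA.
Qed.

Lemma wlim_mono f g : linfty f -> wlim (mulop f \o lreg g) = mulop (pull iota omega f) \o lreg g.
Proof.
move=> fb.
have bid : bounded_ops (id : H -> H).
  by apply/bounded_opsP; split=> //; exists 1 => // x; rewrite mul1r.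
rewrite -[LHS]/(wlim (id \o (mulop f \o lreg g))) (wlim_comp_mono g bid fb).
suff -> : wlim id = id by [].
apply: bounded_ops_ext => //; first exact: wlim_bounded.
move=> i j; rewrite (wlim_coef _ _ bid).
transitivity (ext iota (fun=> (l2delta R i j : C^o)) omega); last by rewrite (ext_cst sc).
congr ext; apply/funext => l; rewrite /= !l2deltaE; congr (_%:R); congr nat_of_bool.
by apply/eqP/eqP => [/mulIg|->].
Qed.

Lemma opnorm_small_eq T S K : (forall e, 0 < e -> opnorm_le (T - S) (K * e)) -> T = S.
Proof.
move=> TS; apply/funext => x; apply/eqP; rewrite -subr_eq0 -normr_le0.
have [x0|x0] := eqVneq `|x| 0.
  by have := TS 1 ltr01 x; rewrite x0 mulr0.
have K0 : 0 <= K.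
  have := TS 1 ltr01 x; rewrite mulr1 => /(le_trans (normr_ge0 _)).
  by rewrite pmulr_lge0// normr_gt0 -normr_eq0.
apply/ler_addgt0Pl => e e0; rewrite addr0.
have K1 : 0 < K * `|x| + 1 by rewrite ltr_wpDl// mulr_ge0.
apply: le_trans (TS _ (divr_gt0 e0 K1) x) _.
rewrite mulrAC mulrCA ger_pMr// ler_pdivrMr// mul1r lerDl; done.
Qed.

(** Weak limits need not be multiplicative on all bounded operators.  For a right
factor that is a finite Fourier sum this is [wlim_comp_mono], and the general
case follows by approximating the right factor in norm. *)
Lemma wlim_comp T S : bounded_ops T -> crossed R G S -> wlim (T \o S) = wlim T \o wlim S.
Proof.
move=> bT cS; have /bounded_opsP[_ [c c0 Tc]] := bT; have bS := crossed_bounded cS.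
apply: (@opnorm_small_eq _ _ (c + c)) => e e0.
have [S' FS' SS'] := fourier_dense cS e0; have bS' := fourier_bounded FS'.
have wS' : wlim (T \o S') = wlim T \o wlim S'.
  elim: FS' => [|f g S1 fb FS1 IH].
    have -> : T \o (0 : H -> H) = 0 by apply/funext => x; exact: (bop0 bT).
    by rewrite wlim0; apply/funext => x; rewrite /= (bop0 (wlim_bounded bT)).
  have bS1 := fourier_bounded FS1; have bm := mono_bounded g fb.
  have -> : T \o (mulop f \o lreg g + S1) = (T \o (mulop f \o lreg g)) + (T \o S1).
    by apply/funext => x; exact: (bopD bT).
  rewrite wlimD; [|exact: bounded_ops_comp|exact: bounded_ops_comp].
  rewrite IH (wlimD bm bS1) (wlim_comp_mono g bT fb) (wlim_mono g fb); apply/funext => x.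
  by rewrite [RHS]/= opDE (bopD (wlim_bounded bT)).
have bD := bounded_opsB bS bS'.
have -> : wlim (T \o S) - (wlim T \o wlim S) = wlim (T \o (S - S')) - (wlim T \o wlim (S - S')).
  have -> : T \o (S - S') = (T \o S) - (T \o S').
    by apply/funext => x; exact: (bopB bT).
  rewrite (wlimB bS bS') (wlimB (bounded_ops_comp bT bS) (bounded_ops_comp bT bS')).
  have -> : wlim T \o (wlim S - wlim S') = (wlim T \o wlim S) - (wlim T \o wlim S').
    by apply/funext => x; exact: (bopB (wlim_bounded bT)).
  by rewrite wS' opprB addrA subrK.
have e0' := ltW e0.
rewrite mulrDl; apply: opnorm_leD.
  by apply: wlim_opnorm; [exact: mulr_ge0|exact: bounded_ops_comp|exact: opnorm_le_comp].
by apply: opnorm_leN; apply: opnorm_le_comp => //; exact: wlim_opnorm.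
Qed.

Lemma wlim_fourier T : fourier T -> fourier (wlim T).
Proof.
elim=> [|f g S fb FS IH]; first by rewrite wlim0; exact: fourier0.
rewrite wlimD; [|exact: mono_bounded|exact: fourier_bounded].
by rewrite wlim_mono//; apply: fourier_cons => //; exact: pull_linfty.
Qed.

Lemma wlim_crossed T : crossed R G T -> crossed R G (wlim T).
Proof.
move=> cT; have bT := crossed_bounded cT; apply: crossed_closed; first exact: wlim_bounded.
move=> e e0; have [S FS TS] := fourier_dense cT e0; have bS := fourier_bounded FS.
exists (wlim S); first by apply: fourier_crossed; exact: wlim_fourier.
by rewrite -wlimB//; apply: wlim_opnorm => //; [exact: ltW|exact: bounded_opsB].
Qed.

Lemma wlim_is_pi_lambda : is_pi_lambda iota omega wlim.
Proof.
split.
- by move=> T /crossed_bounded; exact: wlim_bounded.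
- by move=> c T S /crossed_bounded bT /crossed_bounded bS; exact: wlim_lin.
- by move=> T S /crossed_bounded bT; exact: wlim_comp.
- by move=> T S /crossed_bounded bT /crossed_bounded bS; exact: wlim_adjoint.
split=> [T c cT Tc|f g fb]; last by rewrite wlim_mono// pi_opE.
by apply: wlim_opnorm => //; [exact: (opnorm_le_ge0 1%g Tc)|exact: crossed_bounded].
Qed.

(** Two candidates agree on finite Fourier sums, which are dense, and both are
contractive. *)
Lemma is_pi_lambda_unique Phi T : is_pi_lambda iota omega Phi -> crossed R G T -> Phi T = wlim T.
Proof.
move=> [_ Plin _ _ [Pnorm Pmono]] cT.
have P0 : Phi 0 = 0.
  have := Plin (-1) 0 0 (@crossed0 R G) (@crossed0 R G).
  by rewrite scaler0 addr0 scaleN1r addNr.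
apply: (@opnorm_small_eq _ _ 2) => e e0.
have [S FS TS] := fourier_dense cT e0; have cS := fourier_crossed FS.
have PB : Phi (T - S) = Phi T - Phi S by rewrite addrC -scaleN1r Plin// scaleN1r addrC.
have -> : Phi T - wlim T = Phi (T - S) - wlim (T - S).
  rewrite PB wlimB; [|exact: crossed_bounded..].
  suff -> : Phi S = wlim S by rewrite opprB addrA subrK.
  elim: FS => [|f g S1 fb FS1 IH]; first by rewrite P0 wlim0.
  rewrite wlimD; [|exact: mono_bounded|exact: fourier_bounded].
  rewrite wlim_mono// -IH -[mulop f \o _]scale1r Plin;
    [|exact: crossed_mono|exact: fourier_crossed].
  by rewrite !scale1r Pmono// pi_opE.
rewrite mulr_natl mulr2n; apply: opnorm_leD.
  by apply: Pnorm => //; exact: crossedB.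
apply: opnorm_leN; apply: wlim_opnorm => //; first exact: ltW.
by apply: crossed_bounded; exact: crossedB.
Qed.

(** By uniqueness, the map chosen by the definite description agrees with [wlim] on
the crossed product. *)
Lemma A_omegaE : A_omega R iota omega = wlim @` crossed R G.
Proof.
have P : is_pi_lambda iota omega (@pi_lambda R G bG iota omega).
  by apply: (@xgetPex _ _ [set Phi | is_pi_lambda iota omega Phi]); exists wlim;
    exact: wlim_is_pi_lambda.
by apply/seteqP; split=> _ [T cT <-]; exists T => //; rewrite (is_pi_lambda_unique P).
Qed.

End WeakLimit.

(** * Block decompositions along a non-recurrent point *)

Section Blocks.
Variables (G : groupType) (bG : topologicalType) (iota : G -> bG) (omega : bG).
Hypothesis sc : stone_cech iota.

(** kappa picks, near omega, the left coordinate k out of the product k j, with a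
neighbourhood of omega that depends on k. *)
Definition block_map (kappa : G -> option G) := forall k : G,
  exists V : set bG, [/\ open V, V omega & forall j, V (iota j) -> kappa (k * j)%g = Some k].

(** Let B be a neighbourhood of omega whose closure contains no other translate of
omega, and let kappa x be the element k with k^-1 x in B that comes first in an
enumeration of G.  When j is close to omega, j = k^-1 (k j) lies in B, while
m^-1 (k j) is close to (m^-1 k).omega, hence outside B, for each of the
finitely many m that precede k. *)
Lemma non_recurrent_block_map : countable [set: G] -> non_recurrent iota omega ->
  exists kappa, block_map kappa.
Proof.
move=> /countable_injP[n n_inj] [U [oU Uo recU]].
have [cb hb _ _] := sc.
have [B nB BU] : exists2 B, nbhs omega B & closure B `<=` U.
  apply: (compact_regular hb cb); first exact: filterT.
  exact: open_nbhs_nbhs.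
pose blk k x := B (iota (k^-1 * x)%g) /\ forall m, (n m < n k)%N -> ~ B (iota (m^-1 * x)%g).
have blk_uniq k k' x : blk k x -> blk k' x -> k = k'.
  move=> [Bk nk] [Bk' nk']; case: (ltngtP (n k) (n k')) => nkk'.
  - by have := nk' _ nkk' Bk.
  - by have := nk _ nkk' Bk'.
  - by apply: n_inj => //; rewrite inE.
exists (fun x => if pselect (exists k, blk k x) is left e then Some (projT1 (cid e)) else None).
move=> k.
(* Only finitely many m precede k, so their conditions hold simultaneously
   near omega. *)
have near_blk : \forall w \near omega,
    B w /\ forall i : 'I_(n k), forall m, n m = i -> ~ B (act iota (m^-1 * k)%g w).
  apply: filterI => //; apply: filter_forall => i.
  have [[m nm]|nom] := pselect (exists m, n m = i); last first.
    by apply: nearW => w m nm; case: nom; exists m.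
  have mk : (m^-1 * k)%g <> 1%g.
    move=> mk; have : m = k by rewrite -[m]mulg1 -mk mulVKg.
    by move=> mk'; have := ltn_ord i; rewrite -nm mk' ltnn.
  have : nbhs (act iota (m^-1 * k)%g omega) (~` closure B).
    apply: open_nbhs_nbhs; split; first exact/closed_openC/closed_closure.
    by move=> /BU; exact: recU.
  move=> /(@act_continuous _ _ _ sc (m^-1 * k)%g omega).
  rewrite /= nbhs_simpl /=; apply: filterS => w /= nw m' nm'.
  have -> : m' = m by apply: n_inj; rewrite ?inE// nm nm'.
  by move=> /subset_closure.
have : nbhs omega [set w | B w /\ forall i : 'I_(n k), forall m, n m = i ->
  ~ B (act iota (m^-1 * k)%g w)] := near_blk.
rewrite nbhsE => -[V [oV Vo] VB]; exists V; split=> // j /VB[Bj nBj].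
have kj : blk k (k * j)%g.
  split=> [|m nm]; first by rewrite mulKg.
  by have := nBj (Ordinal nm) m erefl; rewrite act_iota// mulgA.
case: pselect => [e|]; last by case; exists k.
by congr Some; apply: (blk_uniq _ _ (k * j)%g) => //; case: cid.
Qed.

End Blocks.

Section BlockSection.
Variables (R : realType) (G : groupType) (kappa : G -> option G).
Local Notation C := R[i].
Local Notation H := (l2 R G).
Implicit Types (T S : H -> H) (v : H) (f : G -> C^o) (g h j k x : G) (c e : C).

(** Every x with kappa x = k belongs to exactly one block, the one of j = k^-1 x. *)
Lemma esum_blocks (F : G -> \bar R) : (forall x, 0 <= F x)%E ->
  (\esum_(x in [set x | kappa x]) F x =
   \esum_(j in [set: G]) \esum_(k in [set k | kappa (k * j)%g = Some k]) F (k * j)%g)%E.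
Proof.
move=> F0; rewrite esum_esum//.
rewrite (@reindex_esum R (G * G)%type G ([set: G] `*`` (fun j => [set k | kappa (k * j)%g =
  Some k]))
  [set x | kappa x] (fun jk => jk.2 * jk.1)%g)//.
split=> [[j k] [_ /= ->]//|[j k] [j' k']|x].
  rewrite !inE => -[_ /= kj] [_ /= kj'] /= E.
  have kk : k = k' by apply/Some_inj; rewrite -kj -kj' E.
  by move: E; rewrite -kk => /mulgI ->.
rewrite /=; case E : (kappa x) => [k|]// _; exists ((k^-1 * x)%g, k) => /=;
  last by rewrite mulVKg.
by split=> //=; rewrite mulVKg.
Qed.

(** The restriction of v to the block of j, carried back to l2(G) along the map
x = k j |-> k. *)
Definition block j v : H := to_l2 (fun k => if kappa (k * j)%g == Some k then v (k * j)%g else 0).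

Lemma blockE j v k : block j v k = if kappa (k * j)%g == Some k then v (k * j)%g else 0.
Proof.
rewrite /block to_l2E//; apply: (@l2_predI _ _ _ `|v|) => // X.
apply: le_trans (@fsum_comp_le _ _ (fun k => k * j)%g (@mulIg _ _) v X).
by apply: ler_sum => i _; case: ifP => // _; rewrite normr0 expr0n exprn_ge0.
Qed.

Lemma block_lin j a (x y : H) : block j (a *: x + y) = a *: block j x + block j y.
Proof.
apply: l2P => k; rewrite (l2D (a *: block j x)) (l2Z a (block j x)) !blockE.
by case: ifP => // _; rewrite mulr0 addr0.
Qed.

(** The operator that acts as the compression of T on every block and as 0 off the
blocks. *)
Definition block_sum_fun T v : G -> C^o := fun x =>
  if kappa x is Some k then T (block (k^-1 * x)%g v) k else 0.

Definition block_sum T : H -> H := fun v => to_l2 (block_sum_fun T v).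

Lemma norm_le_sqsum (x y : H) : `|x| <= `|y| -> (sqsum x <= sqsum y)%E.
Proof.
have [a a0 [-> ->]] := sqsum_norm x; have [b b0 [-> ->]] := sqsum_norm y.
by rewrite lecR lee_fin => ab; rewrite ler_sqr ?nnegrE.
Qed.

(** Restricted to the block of j, the result is bounded by T (block j v), whose norm
is at most that of block j (c v); the squared norms of the restrictions of c v
to disjoint blocks add up to at most |c v|^2. *)
Lemma block_sum_sqsum T c v : bounded_ops T -> 0 <= c -> opnorm_le T c ->
  (sqsum (block_sum_fun T v) <= sqsum (c *: v : H))%E.
Proof.
move=> bT c0 Tc; rewrite /sqsum.
pose N (z : C) := ((normc z ^+ 2)%:E : \bar R).
have N0 z : (0 <= N z)%E by rewrite lee_fin sqr_ge0.
pose F x := N (block_sum_fun T v x).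
have -> : (\esum_(x in [set: G]) F x = \esum_(x in [set x | kappa x]) F x)%E.
  rewrite [RHS]esum_mkcond; apply: eq_esum => x _; case: ifPn => //.
  by rewrite notin_setE /= /F /block_sum_fun; case: (kappa x) => // _; rewrite /N normc0 expr0n.
apply: (@le_trans _ _ (\esum_(x in [set x | kappa x]) N ((c *: v : H) x))%E); last first.
  rewrite esum_mkcond; apply: le_esum => x _; case: ifP => // _; exact: N0.
rewrite !esum_blocks//; last by move=> x; exact: N0.
apply: le_esum => j _.
apply: (@le_trans _ _ (sqsum (T (block j v)))).
  rewrite /sqsum esum_mkcond; apply: le_esum => k _; case: ifPn; rewrite ?inE//=.
    by move=> kj; rewrite /F /block_sum_fun kj mulKg.
  by move=> _; exact: N0.
(* The constant c moves inside the block, where it becomes a scaling of v. *)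
apply: (@le_trans _ _ (sqsum (block j (c *: v)))).
  apply: norm_le_sqsum; apply: le_trans (Tc _) _.
  have -> : block j (c *: v) = c *: block j v.
    have := block_lin j c v 0; rewrite !addr0 => ->.
    suff -> : block j 0 = 0 by rewrite addr0.
    by apply: l2P => k; rewrite blockE; case: ifP.
  by rewrite normrZ ger0_norm.
rewrite /sqsum [leRHS]esum_mkcond; apply: le_esum => k _; rewrite blockE.
by case: eqP => kj; [rewrite mem_set|rewrite memNset// normc0 expr0n].
Qed.

Lemma block_sumE T v x : bounded_ops T ->
  block_sum T v x = block_sum_fun T v x.
Proof.
move=> bT; rewrite /block_sum to_l2E//; have /bounded_opsP[_ [c c0 Tc]] := bT.
apply/asboolP; apply: le_lt_trans (block_sum_sqsum v bT c0 Tc) _.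
by have /asboolP := l2_fin (c *: v : H).
Qed.

Lemma block_sum_opnorm T c : bounded_ops T -> 0 <= c -> opnorm_le T c ->
  opnorm_le (block_sum T) c.
Proof.
move=> bT c0 Tc v.
have := block_sum_sqsum v bT c0 Tc.
have -> : block_sum_fun T v = block_sum T v.
  by apply/funext => x; rewrite block_sumE.
have -> : c * `|v| = `|c *: v| by rewrite normrZ ger0_norm.
have [a a0 [-> ->]] := sqsum_norm (block_sum T v); have [b b0 [-> ->]] := sqsum_norm (c *: v : H).
by rewrite lecR lee_fin ler_sqr ?nnegrE.
Qed.

Lemma block_sum_lin c T S : bounded_ops T -> bounded_ops S ->
  block_sum (c *: T + S) = c *: block_sum T + block_sum S.
Proof.
move=> bT bS; have bTS := bounded_ops_lin c bT bS; apply/funext => v; apply: l2P => x.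
rewrite opDE opZE (l2D (c *: block_sum T v)) (l2Z c (block_sum T v)).
rewrite (block_sumE _ _ bTS) (block_sumE _ _ bT) (block_sumE _ _ bS) /block_sum_fun.
by case: (kappa x) => //; rewrite mulr0 addr0.
Qed.

Lemma block_sum_bounded T : bounded_ops T -> bounded_ops (block_sum T).
Proof.
move=> bT; have /bounded_opsP[Tl [c c0 Tc]] := bT; apply/bounded_opsP; split; last first.
  by exists c => //; exact: block_sum_opnorm.
move=> a x y; apply: l2P => h.
rewrite (l2D (a *: block_sum T x)) (l2Z a (block_sum T x)).
rewrite [LHS](block_sumE _ _ bT) [X in _ = _ * X + _](block_sumE _ _ bT) [X in _ =
  _ + X](block_sumE _ _ bT) /block_sum_fun.
by case: (kappa h) => [k|]; rewrite ?mulr0 ?addr0// block_lin Tl.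
Qed.

Lemma block_sumB T S : bounded_ops T -> bounded_ops S ->
  block_sum (T - S) = block_sum T - block_sum S.
Proof. by move=> bT bS; rewrite addrC -scaleN1r block_sum_lin// scaleN1r addrC. Qed.

(** The diagonal of [M_f U_g] copied into the blocks; it vanishes where left
multiplication by g^-1 leaves the block. *)
Definition block_coef f g : G -> C^o := fun x =>
  if kappa x is Some k then if kappa (g^-1 * x)%g == Some (g^-1 * k)%g then f k else 0 else 0.

Lemma block_coef_linfty f g : linfty f -> linfty (block_coef f g).
Proof.
move=> /linfty_bound[c c0 fc]; exists c => x; rewrite /block_coef.
by case: (kappa x) => [k|]; rewrite ?normr0//; case: ifP; rewrite ?normr0.
Qed.

Lemma block_sum_mono f g : linfty f ->
  block_sum (mulop f \o lreg g) = mulop (block_coef f g) \o lreg g.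
Proof.
move=> fb; have cb := block_coef_linfty g fb; have bm := mono_bounded g fb.
apply/funext => v; apply: l2P => x.
rewrite (block_sumE _ _ bm) (mono_apply _ _ _ cb) /block_sum_fun /block_coef.
case E : (kappa x) => [k|]; last by rewrite mul0r.
rewrite (mono_apply _ _ _ fb) blockE -mulgA mulVKg.
by case: ifP; rewrite ?mulr0 ?mul0r.
Qed.

Lemma block_sum_fourier T : fourier T -> fourier (block_sum T).
Proof.
elim=> [|f g S fb FS IH].
  have := block_sum_lin (-1) (@bounded_ops0 R H) (@bounded_ops0 R H).
  by rewrite scaler0 addr0 scaleN1r addNr => ->; exact: fourier0.
rewrite -[mulop f \o _]scale1r block_sum_lin; [|exact: mono_bounded|exact: fourier_bounded].
by rewrite scale1r block_sum_mono//; apply: fourier_cons => //; exact: block_coef_linfty.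
Qed.

Lemma block_sum_crossed T : crossed R G T -> crossed R G (block_sum T).
Proof.
move=> cT; have bT := crossed_bounded cT.
apply: crossed_closed; first exact: block_sum_bounded.
move=> e e0; have [S FS TS] := fourier_dense cT e0; have bS := fourier_bounded FS.
exists (block_sum S); first by apply: fourier_crossed; exact: block_sum_fourier.
by rewrite -block_sumB//; apply: block_sum_opnorm => //; [exact: bounded_opsB|exact: ltW].
Qed.

(** Near omega, k j and h j belong to the block of j and kappa maps them to k and h,
so the entry (k j, h j) of [block_sum T] is constantly T(k,h). *)
Lemma wlim_block_sum (bG : topologicalType) (iota : G -> bG) (omega : bG) T :
  stone_cech iota -> block_map iota omega kappa -> bounded_ops T ->
  wlim iota omega (block_sum T) = T.
Proof.
move=> sc kap bT; have bs := block_sum_bounded bT.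
apply: bounded_ops_ext => //; first exact: wlim_bounded.
move=> h k; rewrite (wlim_coef _ sc h k bs).
have [V [oV Vo Vk]] := kap k; have [W [oW Wo Wh]] := kap h.
rewrite (@ext_local _ _ _ _ sc _ (fun=> T (l2delta R h) k) (V `&` W)) ?(ext_cst sc)//.
- exact: coef_linfty.
- exact: linfty_cst.
- exact: openI.
move=> j [/Vk kk /Wh hh]; rewrite (block_sumE _ _ bT) /block_sum_fun kk mulKg; congr (T _ _).
apply: l2P => l; rewrite blockE !l2deltaE.
have -> : (l * j == h * j)%g = (l == h) by apply/eqP/eqP => [/mulIg|->].
by case: ifPn => //; case: (l =P h) => // ->; rewrite hh eqxx.
Qed.

End BlockSection.

(** * Compact operators *)

Section CompactOperators.
Variables (R : realType) (I : choiceType).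
Local Notation C := R[i].
Local Notation H := (l2 R I).
Implicit Types (T S : H -> H) (x y z : H) (X Y : {fset I}) (c e : C) (i : I).
Import summability.
Local Existing Instance totally_filter.

Lemma fproj_bounded X : bounded_ops (fproj X : H -> H).
Proof. by apply: mulop_bounded; exact: (linfty_indic _ (fun i => i \in X)). Qed.

Lemma fprojC_norm X x : `|x - fproj X x| <= `|x|.
Proof.
apply: l2_norm_le => // Y; apply: le_trans (fsum_le_norm2 x Y); apply: ler_sum => i _.
by rewrite (l2B x (fproj X x)) fprojE; case: ifP => _;
  rewrite ?subr0// subrr normr0 expr0n exprn_ge0.
Qed.

(** The projections converge to the identity pointwise and are equicontinuous, hence
they converge uniformly on the compact closure of the image of the unit ball. *)
Lemma compact_fproj_tail T e : compact_ops T -> 0 < e ->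
  exists X, opnorm_le (T - (fproj X \o T)) e.
Proof.
move=> [bT cT] e0; have e2 : 0 < e / 2 by rewrite divr_gt0.
have /compact_near_coveringP/(_ {fset I} totally (fun X y => `|y - fproj X y| <= e) _) := cT.
case=> [y _|X _ /(_ X (fsubset_refl X)) HX].
  have [X HX] := fproj_tail y e2.
  exists ([set y' | `|y - y'| <= e / 2], [set Y | X `<=` Y]%fset).
    split=> /=; last by exists X.
    have /cvgrPdist_le/(_ _ e2) : x @[x --> y] --> y by exact: cvg_id.
    by [].
  move=> [y' Y] /= [yy' /HX {}HX].
  have -> : y' - fproj Y y' = (y - fproj Y y) - ((y - y') - fproj Y (y - y')).
    rewrite (bopB (fproj_bounded Y)).
    have -> : y - y' - (fproj Y y - fproj Y y') = (y - fproj Y y) - (y' - fproj Y y').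
      by rewrite !opprB addrACA [RHS]addrACA; congr (_ + _); exact: addrC.
    by rewrite subKr.
  apply: le_trans (ler_normB _ _) _; rewrite [leRHS]splitr; apply: lerD; first exact: HX.
  exact: le_trans (fprojC_norm _ _) yy'.
exists X => x; have [->|x0] := eqVneq x 0.
  have bTX := bounded_opsB bT (bounded_ops_comp (fproj_bounded X) bT).
  by rewrite (bop0 bTX) normr0 mulr0.
have nx : `|x| != 0 by rewrite normr_eq0.
(* Homogeneity reduces the estimate to the unit vector u. *)
have -> : x = `|x| *: (`|x|^-1 *: x) by rewrite scalerA divff// scale1r.
set u := _ *: x.
have u1 : `|u| = 1 by rewrite normrZ ger0_norm ?invr_ge0// mulVf.
have bTX := bounded_opsB bT (bounded_ops_comp (fproj_bounded X) bT).
rewrite (bopZ bTX) (normrZ _ u) (normrZ _ ((T - _) u)) u1 mulr1 normr_id mulrC ler_wpM2r//.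
by apply: HX; apply: subset_closure; exists u => //=; rewrite u1.
Qed.

(** Let s be the sum on the left.  Evaluating T at the conjugated partial row z gives
s = (T z)(i) <= c |z| with |z|^2 = s. *)
Lemma row_fsum_le T c i X : bounded_ops T -> 0 <= c -> opnorm_le T c ->
  \sum_(h <- X) `|T (l2delta R h) i| ^+ 2 <= c ^+ 2.
Proof.
move=> bT c0 Tc; set s := \sum_(h <- X) _.
pose z : H := \sum_(h <- X) (T (l2delta R h) i)^* *: l2delta R h.
have s0 : 0 <= s by apply: sumr_ge0 => h _; exact: exprn_ge0.
have Tz : T z i = s.
  rewrite /z (bop_sum bT) l2_sum; apply: eq_bigr => h _.
  by rewrite (bopZ bT) (l2Z _ (T _)) normCKC.
have zz : `|z| ^+ 2 = s.
  rewrite -l2dotxx {1}/z l2dot_suml /s big_seq [RHS]big_seq; apply: eq_bigr => h hX.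
  rewrite -[_ *: l2delta R h]addr0 l2dot_lin l2dot0 addr0 l2delta_dot fsum_delta hX.
  by rewrite conjCK normCKC.
have : s <= c * `|z|.
  rewrite -[s]ger0_norm// -Tz; exact: le_trans (l2_coord_le _ _) (Tc z).
have [z0|z0] := eqVneq `|z| 0; first by rewrite -zz z0 expr0n /= exprn_ge0.
have zp : 0 < `|z| by rewrite lt_def z0 normr_ge0.
by rewrite -zz expr2 ler_pM2r// => zc; rewrite expr2 ler_pM.
Qed.

Lemma fproj_adjoint X : is_adjoint (fproj X : H -> H) (fproj X).
Proof.
apply/is_adjointP; [exact: fproj_bounded|exact: fproj_bounded|move=> i j].
rewrite (fprojE X (l2delta R i)) (fprojE X (l2delta R j)) !l2deltaE; have [->|ij] := eqVneq i j.
  by case: (j \in X); rewrite /= ?eqxx ?conjC1 ?conjC0.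
by rewrite !if_same conjC0.
Qed.

(** The functional x |-> (T x)(i) is the inner product with the i-th conjugated row of
T, which is square-summable by [row_fsum_le]; its tails are small. *)
Lemma row_tail T i e : bounded_ops T -> 0 < e ->
  exists Y, forall x, `|T (x - fproj Y x) i| <= e * `|x|.
Proof.
move=> bT e0; have /bounded_opsP[Tl [c c0 Tc]] := bT.
have rP : (fun h => (T (l2delta R h) i)^* : C^o) \in @l2_pred R I.
  apply: (l2_predI c0) => X; under eq_bigr do rewrite norm_conjC.
  exact: row_fsum_le.
pose r : H := L2 rP.
have Tr x : T x i = l2dot x r.
  apply/eqP; rewrite -subr_eq0; apply/eqP.
  pose f (x : H) : C^o := T x i - l2dot x r.
  apply: (@l2_linear_vanish _ _ C^o f (c + `|r|)); rewrite /f.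
  - by rewrite addr_ge0.
  - move=> a u v; rewrite Tl l2dot_lin (l2D (a *: T u)) (l2Z a (T u)).
    by rewrite opprD addrACA -mulrBr.
  - move=> u; apply: le_trans (ler_normB _ _) _; rewrite mulrDl; apply: lerD.
      exact: le_trans (l2_coord_le _ _) (Tc u).
    by rewrite mulrC cauchy_schwarz.
  by move=> h; rewrite l2delta_dot /= conjCK subrr.
have [Y /(_ Y (fsubset_refl Y)) HY] := fproj_tail r e0; exists Y => x.
rewrite Tr l2dotBl fproj_adjoint -l2dotBr.
by apply: le_trans (cauchy_schwarz _ _) _; rewrite mulrC ler_wpM2r.
Qed.

(** The image of the unit ball is contained in the multiples of one basis vector by
scalars from the closed unit disc. *)
Lemma compact_ops_delta i : compact_ops (mulop (fun k => (k == i)%:R) : H -> H).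
Proof.
have fb : linfty (fun k => (k == i)%:R : C^o) := linfty_indic _ (fun k => k == i).
split; first exact: mulop_bounded.
pose D : set H := (fun a : C^o => a *: l2delta R i) @` [set a | `|a| <= 1].
have cD : compact D.
  apply: continuous_compact; last exact: disc_compact.
  apply: continuous_subspaceT => a; exact: scalel_continuous.
apply: (subclosed_compact _ cD); first exact: closed_closure.
have Dc : closed D := compact_closed (@norm_hausdorff _ _) cD.
apply: (subset_trans _ Dc).
apply: closure_subset => _ [x /= x1 <-]; exists (x i).
  exact: le_trans (l2_coord_le _ _) x1.
apply: l2P => k; rewrite (l2Z (x i)) (mulopE _ _ fb) l2deltaE.
by case: eqP => [->|_]; rewrite ?mulr1 ?mul1r// mulr0 mul0r.
Qed.

End CompactOperators.

Section CompactInCrossed.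
Variables (R : realType) (G : groupType).
Local Notation C := R[i].
Local Notation H := (l2 R G).
Implicit Types (T S : H -> H) (x y : H) (e : C) (g h i k : G).

Lemma linfty_delta i : linfty (fun k => (k == i)%:R : C^o).
Proof. exact: (linfty_indic _ (fun k => k == i)). Qed.

Lemma crossed_sum (X : {fset G}) (F : G -> H -> H) : (forall i, crossed R G (F i)) ->
  crossed R G (\sum_(i <- X) F i).
Proof.
move=> cF; elim/big_rec: _ => [|i T _ cT]; first exact: crossed0.
exact: crossedD.
Qed.

Lemma op_sumE (X : {fset G}) (F : G -> H -> H) x : (\sum_(i <- X) F i) x = \sum_(i <- X) F i x.
Proof. by elim/big_rec2: _ => [|i y T _ <-]. Qed.

(** Cutting the i-th row after finitely many entries T(i,h) leaves a finite combination
of the operators M_(delta_i) U_(i h^-1), and [row_tail] bounds the error in norm. *)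
Lemma row_crossed T i : bounded_ops T -> crossed R G (mulop (fun k => (k == i)%:R) \o T).
Proof.
move=> bT; have fb := linfty_delta i; have bm := mulop_bounded fb.
apply: crossed_closed; first exact: bounded_ops_comp.
move=> e e0; have [Y HY] := row_tail i bT e0.
exists (\sum_(h <- Y) T (l2delta R h) i *: (mulop (fun k => (k == i)%:R) \o lreg (i * h^-1)%g)).
  apply: crossed_sum => h; rewrite -[_ *: _]addr0; apply: crossed_lin; last exact: crossed0.
  exact: crossed_mono.
move=> x; apply: le_trans (HY x).
rewrite [X in `|X| <= _](_ : _ = T (x - fproj Y x) i *: l2delta R i).
  by rewrite normrZ norm_l2delta mulr1.
apply: l2P => k; rewrite opBE op_sumE (l2B _ (\sum_(h <- Y) _)) l2_sum (l2Z _ (l2delta R i))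
  l2deltaE.
rewrite /= (mulopE _ _ fb) (bopB bT) (l2B (T x)) fprojEsum (bop_sum bT) l2_sum.
have cE h : (T (l2delta R h) i *: mulop (fun k => (k == i)%:R) (lreg (i * h^-1)%g x)) k =
    (k == i)%:R * (T (l2delta R h) i * x h).
  rewrite (l2Z _ (mulop _ _)) (mulopE _ _ fb) lregE; case: eqP => [->|_].
    by rewrite !mul1r invgM invgK mulgVK.
  by rewrite !mul0r mulr0.
rewrite (eq_bigr (fun h => (k == i)%:R * (T (l2delta R h) i * x h))); last by move=> h _;
  exact: cE.
rewrite -mulr_sumr -mulrBr mulrC; case: eqP => [->|_]; last by rewrite !mulr0.
rewrite !mulr1; congr (_ - _); apply: eq_bigr => h _.
by rewrite (bopZ bT) (l2Z _ (T _)) mulrC.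
Qed.

Lemma compact_crossed T : compact_ops T -> crossed R G T.
Proof.
move=> kT; have bT := kT.1; apply: crossed_closed => // e e0.
have [X HX] := compact_fproj_tail kT e0; exists (fproj X \o T) => //.
have -> : fproj X \o T = \sum_(i <- X) (mulop (fun k => (k == i)%:R) \o T).
  apply/funext => x; rewrite op_sumE /= fprojEsum; apply: eq_bigr => i _.
  apply: l2P => k; rewrite (l2Z (T x i)) (mulopE _ _ (linfty_delta i)) l2deltaE.
  by case: eqP => [->|_]; rewrite ?mulr1 ?mul1r// mulr0 mul0r.
by apply: crossed_sum => i; exact: row_crossed.
Qed.

End CompactInCrossed.

(** * The implications *)

Section Implications.
Variables (R : realType) (G : groupType) (bG : topologicalType) (iota : G -> bG).
Variable omega : bG.
Local Notation C := R[i].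
Local Notation H := (l2 R G).
Hypothesis sc : stone_cech iota.
Local Notation wlim := (@wlim R G bG iota omega).
Implicit Types (f : G -> C^o) (g h j k : G) (e : C).

Lemma A_omega_crossed : A_omega R iota omega `<=` crossed R G.
Proof. by rewrite A_omegaE// => _ [T cT <-]; exact: wlim_crossed. Qed.

(** The entries (k, h) with h k^-1 fixed form a function of k that extends
continuously along k |-> k.omega. *)
Lemma wlim_diag (T : H -> H) k h : bounded_ops T ->
  wlim T (l2delta R h) k = pull iota omega (fun x => T (l2delta R (h * k^-1 * x)%g) x) k.
Proof.
move=> bT; rewrite wlim_coef// pullE//; last first.
  have /bounded_opsP[_ [c c0 Tc]] := bT; exists c => x; exact: opnorm_le_coef.
by congr ext; apply/funext => j; rewrite mulgA mulgVK.
Qed.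

Lemma diagonal_linfty (T : H -> H) g : bounded_ops T ->
  linfty (fun x => T (l2delta R (g * x)%g) x : C^o).
Proof. by move=> /bounded_opsP[_ [c c0 Tc]]; exists c => x; exact: opnorm_le_coef. Qed.

Lemma block_map_crossed kappa : block_map iota omega kappa -> A_omega R iota omega = crossed R G.
Proof.
move=> kap; apply/seteqP; split; first exact: A_omega_crossed.
rewrite A_omegaE// => T cT; exists (block_sum kappa T); first exact: block_sum_crossed.
by apply: wlim_block_sum => //; exact: crossed_bounded.
Qed.

Lemma A_omega_full_compact : A_omega R iota omega = crossed R G ->
  @compact_ops R H `<=` A_omega R iota omega.
Proof. by move=> -> T; exact: compact_crossed. Qed.

Lemma A_omega0 : A_omega R iota omega 0.
Proof. by rewrite A_omegaE//; exists 0; [exact: crossed0|exact: wlim0]. Qed.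

Lemma compact_sub_meets : @compact_ops R H `<=` A_omega R iota omega ->
  @compact_ops R H `&` A_omega R iota omega <> [set 0].
Proof.
move=> KA K0; have kd := compact_ops_delta R (1%g : G).
have : [set 0] (mulop (fun k => (k == 1%g)%:R) : H -> H) by rewrite -K0; split=> //; exact: KA.
move=> /= /(congr1 (fun T : H -> H => T (l2delta R 1%g) 1%g)).
rewrite (mulopE _ _ (linfty_delta R 1%g)) l2deltaE eqxx mul1r.
by move/eqP; rewrite oner_eq0.
Qed.

(** The stabilizer of omega is contained in the finite set E, so it is trivial; the
finitely many translates of omega by the other elements of E differ from
omega and can be removed from V. *)
Lemma stabilizer_trivial (E : set G) (V : set bG) : no_finite_subgroups G ->
  open V -> V omega -> finite_set E -> (forall g, V (act iota g omega) -> E g) ->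
  non_recurrent iota omega.
Proof.
move=> nofin oV Vo Ef VE; have [_ hb _ _] := sc.
pose stab : {pred G} := fun g => `[< act iota g omega = omega >].
have stab1 g : act iota g omega = omega -> g = 1%g.
  move=> go; apply: (nofin stab); last exact/asboolP.
    split; first by apply/asboolP; exact: act1.
    move=> u v /asboolP uo /asboolP vo; apply/asboolP.
    by rewrite -(act_mul sc u) -{1}vo (act_mul sc v^-1%g) mulVg act1.
  apply: sub_finite_set Ef => u /asboolP uo; apply: VE; by rewrite uo.
pose D : set bG := (fun g => act iota g omega) @` (E `\ 1%g).
have Df : finite_set D by apply: finite_image; exact: finite_setD.
have Dc : closed D by apply: (accessible_finite_set_closed.1 (hausdorff_accessible hb)).
exists (V `&` ~` D); split.
- by apply: openI => //; exact: closed_openC.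
- by split=> // -[g [_ /=]] g1 /stab1.
move=> g g1 [Vg]; apply; exists g => //; split => //; exact: VE.
Qed.

(** Some diagonal of the compact operator does not vanish.  It has the form
l |-> F(l.omega) with F continuous and is small for l outside a finite set,
whereas |F| is large near k.omega. *)
Lemma compact_meets_non_recurrent : no_finite_subgroups G ->
  @compact_ops R H `&` A_omega R iota omega <> [set 0] -> non_recurrent iota omega.
Proof.
move=> nofin KA.
have [T [kT [AT T0]]] : exists T : H -> H, compact_ops T /\ A_omega R iota omega T /\ T <> 0.
  apply: contrapT => noT; apply: KA; apply/seteqP; split => [T [kT AT]|T ->].
    by apply: contrapT => T0; apply: noT; exists T.
  split; last exact: A_omega0.
  split; first exact: bounded_ops0.
  apply: (@subclosed_compact _ _ [set 0]); [exact: closed_closure|exact: compact_set1|].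
  have cl0 : closed [set (0 : H)].
    by apply: compact_closed; [exact: norm_hausdorff|exact: compact_set1].
  apply: (subset_trans _ cl0); apply: closure_subset.
  by move=> _ [x _ <-].
have bT := kT.1.
have [h [k Thk]] : exists h k, T (l2delta R h) k != 0.
  apply: contrapT => noT; apply: T0; apply: bounded_ops_ext => //; first exact: bounded_ops0.
  move=> h k; apply/eqP; apply: contrapT => /negP Thk; apply: noT; by exists h, k.
move: AT; rewrite A_omegaE// => -[S cS ST]; have bS := crossed_bounded cS.
pose f x : C^o := S (l2delta R (h * k^-1 * x)%g) x.
have fb : linfty f := diagonal_linfty _ bS.
have Tf l : T (l2delta R (h * k^-1 * l)%g) l = ext iota f (act iota l omega).
  by rewrite -ST wlim_diag//; congr (pull _ _ _ _); apply/funext => x; rewrite mulgK.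
(* Half of the entry (k, h): the diagonal exceeds it at k, but only at finitely
   many other places. *)
pose e : C := `|T (l2delta R h) k| / 2.
have e0 : 0 < e by rewrite divr_gt0 ?normr_gt0.
have [X HX] := compact_fproj_tail kT e0.
pose W := [set w | ~ (`|ext iota f w| <= e)].
have oW : open W.
  rewrite (_ : W = ext iota f @^-1` ~` [set z : C^o | `|z| <= e])//.
  apply: open_comp; last by apply: closed_openC; exact: disc_closed.
  by move=> w _; exact: ext_continuous.
have WX l : W (act iota l omega) -> l \in X.
  move=> Wl; apply: contrapT => /negP lX; apply: Wl; rewrite -Tf.
  have := opnorm_le_coef (h * k^-1 * l)%g l HX.
  by rewrite opBE (l2B (T _)) /= (fprojE X (T _)) (negbTE lX) subr0.
pose V := act iota k @^-1` W.
apply: (@stabilizer_trivial [set g | k * g \in X]%g V) => //.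
- by apply: open_comp => // w _; exact: act_continuous.
- rewrite /V /W /= -Tf mulgVK.
  apply/negP; rewrite -real_ltNge ?realE ?normr_ge0 ?(ltW e0)//.
  by rewrite /e ltr_pdivrMr// ltr_pMr ?normr_gt0// ltr1n.
- apply: (@sub_finite_set _ _ [set (k^-1 * x)%g | x in [set` X]]).
    by move=> g /= gX; exists (k * g)%g => //; rewrite mulKg.
  by apply: finite_image; exact: finite_fset.
by move=> g /=; rewrite /V /= act_mul//; exact: WX.
Qed.

Lemma A_omega_full_pi_onto : A_omega R iota omega = crossed R G ->
  set_surj (diag_ops R G) (diag_ops R G) (pi_op iota omega).
Proof.
move=> AE _ [f fb <-]; have : A_omega R iota omega (mulop f) by rewrite AE; exact: crossed_mulop.
rewrite A_omegaE// => -[T cT Tf]; have bT := crossed_bounded cT.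
pose d x : C^o := T (l2delta R (1 * x)%g) x.
have db : linfty d := diagonal_linfty _ bT.
exists (mulop d); first by exists d.
rewrite pi_opE//; congr mulop; apply/funext => k.
have := wlim_diag k k bT; rewrite Tf mulgV (mulopE _ _ fb) l2deltaE eqxx mulr1.
by move=> ->.
Qed.

(** The indicator function of the trace on G of one of two disjoint neighbourhoods. *)
Lemma sc_separates (a b : bG) : a <> b -> exists f, linfty f /\ ext iota f a <> ext iota f b.
Proof.
move=> /eqP ab; have [_ hb _ _] := sc.
move: hb; rewrite open_hausdorff => /(_ _ _ ab)[[A B] /= [aA bB] [oA oB /eqP AB]].
pose f g : C^o := (iota g \in A)%:R.
have fb : linfty f := linfty_indic R (fun g => iota g \in A).
exists f; split=> //.
rewrite (@ext_local _ _ _ _ sc f (fun=> 1) A a)//; last 3 first.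
- exact: linfty_cst.
- exact: set_mem.
- by move=> j Aj; rewrite /f mem_set.
rewrite (@ext_local _ _ _ _ sc f (fun=> 0) B b)//; last 3 first.
- exact: linfty_cst.
- exact: set_mem.
- move=> j Bj; rewrite /f memNset// => Aj.
  by have : (A `&` B) (iota j); [split|rewrite AB].
by rewrite !(ext_cst sc); move/eqP; rewrite oner_eq0.
Qed.

Lemma pi_onto_rtrans_inj : set_surj (diag_ops R G) (diag_ops R G) (pi_op iota omega) ->
  injective (rtrans iota omega).
Proof.
move=> onto a b rab; apply: contrapT => /sc_separates[f [fb]]; apply.
have [|_ [d db <-] df] := onto (mulop f); first by exists f.
have -> : f = pull iota omega d.
  rewrite -[LHS]diag_coefE// -df pi_opE// diag_coefE//.
  exact: pull_linfty.
by rewrite -!ext_rtrans// rab.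
Qed.

(** The extension of the indicator function of {g} vanishes at every other point. *)
Lemma sc_isolated g : exists2 V : set bG, open V & V (iota g) /\ (forall w, V w -> w = iota g).
Proof.
have fb := linfty_delta R g; have [_ hb _ _] := sc.
pose F := ext iota (fun k => (k == g)%:R : C^o).
have cF : continuous F by exact: ext_continuous.
exists (F @^-1` ~` [set 0]).
  apply: open_comp; first by move=> w _; exact: cF.
  apply: closed_openC; apply: compact_closed; [exact: norm_hausdorff|exact: compact_set1].
split=> [/=|w Fw].
  by rewrite /F ext_iota// eqxx => /eqP; rewrite oner_eq0.
apply: (@sc_eq_local _ _ _ sc bG id (fun=> iota g) (F @^-1` ~` [set 0])) => //.
- by move=> v; exact: cvg_id.
- by move=> v; exact: cvg_cst.
- apply: open_comp; first by move=> v _; exact: cF.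
  apply: closed_openC; apply: compact_closed; [exact: norm_hausdorff|exact: compact_set1].
move=> j; rewrite /= /F ext_iota//; case: eqP => [->//|_]; by case.
Qed.

(** The image of the complement of the isolated point 1 is compact.  By injectivity it
misses omega = rtrans 1, and it contains g.omega = rtrans g for g <> 1. *)
Lemma rtrans_inj_non_recurrent : injective (rtrans iota omega) -> non_recurrent iota omega.
Proof.
move=> inj; have [cb hb _ _] := sc.
have [V oV [V1 VP]] := sc_isolated 1%g.
have iotaI g : iota g = iota 1%g -> g = 1%g.
  move=> g1; have fb := linfty_delta R (1%g : G).
  have := ext_iota sc g fb; rewrite g1 (ext_iota sc _ fb) eqxx.
  by case: eqP => // _ /eqP; rewrite oner_eq0.
have o1 : rtrans iota omega (iota 1%g) = omega by rewrite rtrans_iota// act1.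
exists (~` (rtrans iota omega @` ~` V)); split.
- apply: closed_openC; apply: (compact_closed hb); apply: continuous_compact.
    by apply: continuous_subspaceT; exact: rtrans_continuous.
  by apply: (subclosed_compact _ cb) => //; exact: open_closedC.
- by move=> [v nVv]; rewrite -[in RHS]o1 => /inj vE; apply: nVv; rewrite vE.
move=> g g1; apply; exists (iota g); last exact: rtrans_iota.
by move=> /VP/iotaI.
Qed.

End Implications.

Theorem theorem19 (R : realType) (G : groupType) (bG : topologicalType)
    (iota : G -> bG) (omega : bG) :
  countable [set: G] ->
  no_finite_subgroups G ->
  stone_cech iota ->
  [<-> non_recurrent iota omega;
       @compact_ops R (l2 R G) `&` A_omega R iota omega <> [set 0];
       @compact_ops R (l2 R G) `<=` A_omega R iota omega;
       set_surj (diag_ops R G) (diag_ops R G) (pi_op iota omega);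
       A_omega R iota omega = crossed R G;
       injective (rtrans iota omega);
       right_cancellative iota omega].
Proof.
move=> countG nofin sc.
have full : non_recurrent iota omega -> A_omega R iota omega = crossed R G.
  by move=> /(non_recurrent_block_map sc countG)[kappa]; exact: block_map_crossed.
have inj_rec : injective (rtrans iota omega) -> non_recurrent iota omega.
  exact: (rtrans_inj_non_recurrent R sc).
have meets_rec := @compact_meets_non_recurrent R G bG iota omega sc nofin.
have onto_inj := @pi_onto_rtrans_inj R G bG iota omega sc.
have full_onto := @A_omega_full_pi_onto R G bG iota omega sc.
tfae.
- by move=> /full/A_omega_full_compact; exact: compact_sub_meets.
- by move=> /meets_rec/full/A_omega_full_compact.
- by move=> /compact_sub_meets/meets_rec/full/full_onto.
- by move=> /onto_inj/inj_rec/full.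
- by move=> /full_onto/onto_inj.
- by [].
exact: inj_rec.
Qed.
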